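(* Consider the system of second-order ODEs for a nondegenerate real $2\times 2$ matrix $F(t)=(F_{ik}(t))_{i,k=1,2}$ $$\ddot F_{ik}+\frac{\partial U}{\partial F_{ik}}+l\sum_j L_{ij}\dot F_{jk}-\delta\,\omega^2(\mathcal D F)_{ik}=0,\qquad i,k=1,2,$$ in the case $\delta=1$, $\mathcal D=\mathrm{diag}(1,k)$ with $k=1$ (so that $l=2\omega$), and $\gamma=2$, where $L=\begin{pmatrix}0&-1\\1&0\end{pmatrix}$ and $U=U_0|\det F|^{-\gamma}\det F$ with $U_0=\mathrm{const}>0$. This system can be reduced to the one ODE $$u'(t)=\pm\frac{1}{s^2(t)}\sqrt{f(u)}$$ and integrated. Here $$f(u)=D-\frac{4U_0}{\sin 2u}-\frac{A^2+B^2+2AB\sin 2u}{\cos^2 2u},\qquad D=\frac{8(\tilde E+\omega A)k_0-k_1^2}{4}=\mathrm{const},\qquad s^2(t)=G(t),$$ where $u,s$ are the variables and $G,\tilde E,A,B,k_0,k_1$ the quantities defined in the context.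
   Context: Dots and primes denote time derivatives. The system describes, in Lagrangian coordinates, motions with uniform deformation of a 2D gas with heat ratio $\gamma$ on a rotating plane; $\omega>0$ is the angular velocity, $l=2\omega\sin\theta$ is the Coriolis parameter at latitude $\theta$, $k=\sin^2\theta$, and $\delta=1$ or $\delta=0$ according to whether the centrifugal term is included or not. The variables $s,u,v,w$ (functions of $t$) are introduced by the change of variables $$F=\begin{pmatrix}\cos v&-\sin v\\ \sin v&\cos v\end{pmatrix}\begin{pmatrix}s\cos u&0\\0&s\sin u\end{pmatrix}\begin{pmatrix}\cos w&-\sin w\\ \sin w&\cos w\end{pmatrix}.$$ Put $G=\sum_{i,k}F_{ik}^2$. In the case considered, the system has the first integrals (constants along each solution) $$\tilde E=\tfrac12\sum_{i,k}\dot F_{ik}^2+U-\tfrac12\omega^2G,$$ $$A=F_{11}\dot F_{21}+F_{12}\dot F_{22}-F_{21}\dot F_{11}-F_{22}\dot F_{12}+\omega G,$$ $$B=F_{11}\dot F_{12}+F_{21}\dot F_{22}-F_{12}\dot F_{11}-F_{22}\dot F_{21}-2\omega\det F,$$ and along each solution $G(t)=2(\tilde E+\omega A)t^2+k_1t+k_0$ with constants $k_0,k_1$. *)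

(* Defs.v *)
From Stdlib Require Import Reals.
From Coquelicot Require Import Coquelicot.
Open Scope R_scope.

(* Matrix indices range over {0, 1}, so the index 0 stands for the 1 of the
   usual notation F_11, F_12, ... *)
Definition mat2 : Type := @matrix R 2 2.

Definition entry (M : mat2) (i j : nat) : R := coeff_mat 0 M i j.

Definition mat2_of (m11 m12 m21 m22 : R) : mat2 := [[m11, m12], [m21, m22]].

Definition mul2 (M N : mat2) : mat2 := @Mmult R_Ring 2 2 2 M N.

Definition det2 (M : mat2) : R :=
  entry M 0 0 * entry M 1 1 - entry M 0 1 * entry M 1 0.

Definition Gsq (M : mat2) : R :=
  sum_n (fun i => sum_n (fun j => entry M i j ^ 2) 1) 1.

Definition rot (x : R) : mat2 := mat2_of (cos x) (- sin x) (sin x) (cos x).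

Definition Lmat : mat2 := mat2_of 0 (-1) 1 0.

(* Rpower is the real power, meaningful for a positive base: the potential is
   only considered where det M <> 0. *)
Definition potential (U0 gamma : R) (M : mat2) : R :=
  U0 * Rpower (Rabs (det2 M)) (- gamma) * det2 M.

Definition replace_entry (M : mat2) (i j : nat) (x : R) : mat2 :=
  mk_matrix 2 2 (fun p q =>
    if andb (Nat.eqb p i) (Nat.eqb q j) then x else entry M p q).

Definition partial (W : mat2 -> R) (i j : nat) (M : mat2) : R :=
  Derive (fun x => W (replace_entry M i j x)) (entry M i j).

Definition Fdot (F : R -> mat2) (i j : nat) (t : R) : R :=
  Derive (fun x => entry (F x) i j) t.

Definition Fddot (F : R -> mat2) (i j : nat) (t : R) : R :=
  Derive (Fdot F i j) t.

Definition in_itv (a b : Rbar) (t : R) : Prop := Rbar_lt a t /\ Rbar_lt t b.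

Definition is_motion (U0 gamma omega l delta kappa : R) (a b : Rbar)
    (F : R -> mat2) : Prop :=
  forall t, in_itv a b t ->
    det2 (F t) <> 0 /\
    forall i j : nat, (i < 2)%nat -> (j < 2)%nat ->
      ex_derive (fun x => entry (F x) i j) t /\
      ex_derive (Fdot F i j) t /\
      Fddot F i j t
      + partial (potential U0 gamma) i j (F t)
      + l * sum_n (fun m => entry Lmat i m * Fdot F m j t) 1
      - delta * omega ^ 2 * entry (mul2 (mat2_of 1 0 0 kappa) (F t)) i j = 0.

Definition energy (U0 gamma omega : R) (F : R -> mat2) (t : R) : R :=
  / 2 * sum_n (fun i => sum_n (fun j => Fdot F i j t ^ 2) 1) 1
  + potential U0 gamma (F t) - / 2 * omega ^ 2 * Gsq (F t).

Definition integralA (omega : R) (F : R -> mat2) (t : R) : R :=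
  entry (F t) 0 0 * Fdot F 1 0 t + entry (F t) 0 1 * Fdot F 1 1 t
  - entry (F t) 1 0 * Fdot F 0 0 t - entry (F t) 1 1 * Fdot F 0 1 t
  + omega * Gsq (F t).

Definition integralB (omega : R) (F : R -> mat2) (t : R) : R :=
  entry (F t) 0 0 * Fdot F 0 1 t + entry (F t) 1 0 * Fdot F 1 1 t
  - entry (F t) 0 1 * Fdot F 0 0 t - entry (F t) 1 1 * Fdot F 1 0 t
  - 2 * omega * det2 (F t).

Definition first_integrals (U0 gamma omega : R) (a b : Rbar) (F : R -> mat2)
    (E A B k0 k1 : R) : Prop :=
  forall t, in_itv a b t ->
    energy U0 gamma omega F t = E /\
    integralA omega F t = A /\
    integralB omega F t = B /\
    Gsq (F t) = 2 * (E + omega * A) * t ^ 2 + k1 * t + k0.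

Definition new_variables (c d : Rbar) (F : R -> mat2) (s u v w : R -> R) : Prop :=
  forall t, in_itv c d t ->
    ex_derive s t /\ ex_derive u t /\ ex_derive v t /\ ex_derive w t /\
    F t = mul2 (mul2 (rot (v t))
                     (mat2_of (s t * cos (u t)) 0 0 (s t * sin (u t))))
               (rot (w t)).

Definition radicandD (omega E A k0 k1 : R) : R :=
  (8 * (E + omega * A) * k0 - k1 ^ 2) / 4.

Definition radicand (U0 A B D x : R) : R :=
  D - 4 * U0 / sin (2 * x)
  - (A ^ 2 + B ^ 2 + 2 * A * B * sin (2 * x)) / cos (2 * x) ^ 2.

Definition is_sign (sigma : R) : Prop := sigma = 1 \/ sigma = -1.

Definition reduced_ode (U0 A B D : R) (s u : R -> R) (t : R) : Prop :=
  0 <= radicand U0 A B D (u t) /\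
  exists sigma, is_sign sigma /\
    is_derive u t (sigma * (/ (s t ^ 2) * sqrt (radicand U0 A B D (u t)))).

(* The definitions of A and B are linear in v' and w':
   A = s^2 (v' + omega + w' sin 2u),  B = - s^2 ((v' + omega) sin 2u + w').
   Solving them gives v' = v_rate and w' = w_rate. *)
Definition v_rate (omega A B : R) (s u : R -> R) (t : R) : R :=
  (A + B * sin (2 * u t)) / (s t ^ 2 * cos (2 * u t) ^ 2) - omega.

Definition w_rate (A B : R) (s u : R -> R) (t : R) : R :=
  - (B + A * sin (2 * u t)) / (s t ^ 2 * cos (2 * u t) ^ 2).

(* Separation of variables in the reduced equation. *)
Definition u_quadrature (U0 A B D : R) (s u : R -> R) (c d : Rbar) : Prop :=
  exists sigma, is_sign sigma /\
    forall t0 t, in_itv c d t0 -> in_itv c d t ->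
      exists T,
        is_RInt (fun x => / (s x ^ 2)) t0 t T /\
        is_RInt (fun y => / sqrt (radicand U0 A B D y)) (u t0) (u t) (sigma * T).

Definition vw_quadratures (omega A B : R) (s u v w : R -> R) (c d : Rbar) : Prop :=
  forall t0 t, in_itv c d t0 -> in_itv c d t ->
    is_RInt (v_rate omega A B s u) t0 t (v t - v t0) /\
    is_RInt (w_rate A B s u) t0 t (w t - w t0).

(* Main.v *)
(** In the frame rotating with angular velocity [omega] the system becomes the free motion in
    the potential [U], which for [gamma = 2] is [U0 / det F], hence invariant under left and
    right rotations and homogeneous of degree -2. Invariance gives [A] and [B], homogeneity
    gives [G'' = 4 (E + omega A)]. In the new variables, [2 G (E + omega A)] is
    [(G'/2)^2 + (s^2 u')^2 + 4 U0 / sin 2u] plus the part coming from [A] and [B]; since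
    [2 G (E + omega A) - (G'/2)^2] is the constant [D], this is [(s^2 u')^2 = f u].

    Conversely, if [E], [A], [B] and [G - 2 (E + omega A) t^2 - k1 t] are constant, then the
    residual of the equations of motion is orthogonal to [F'], [J F], [F J] and [F].  These
    are independent where [u' <> 0], so the residual vanishes there, and everywhere by
    continuity. *)

Require Import Defs.
From Stdlib Require Import Reals Lra Lia Classical.
From Coquelicot Require Import Coquelicot.
Open Scope R_scope.

(** * Intervals *)

(** [D] is minus a quarter of the discriminant of the quadratic polynomial [G]; this is why
    [2 G (E + omega A) - (G'/2)^2] does not depend on time.

    The time derivatives of [E], [A], [B] and [G'/2] are computed along an arbitrary twice derivable
    curve, as linear forms in the residual. Read one way they give conservation along motions, read
    the other way the orthogonality relations of the converse.

    Regularity is the obstacle on both sides. Forward, a singular value decomposition can only be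
    chosen differentiably away from equal singular values, so the angles are built as primitives.
    Backward, the argument at the zeros of [u'] needs a continuous residual, hence entries of [F]
    with continuous second derivatives; of these only the regularity of [u] has to be assumed, as
    [s], [v] and [w] inherit theirs from it and from the polynomial [G]. *)

Lemma in_itv_locally a b t : in_itv a b t -> locally t (in_itv a b).
Proof.
  intros [Ha Hb].
  apply filter_and; [exact (open_Rbar_gt a t Ha) | exact (open_Rbar_lt b t Hb)].
Qed.

Lemma in_itv_between a b t1 t2 x :
  in_itv a b t1 -> in_itv a b t2 -> Rmin t1 t2 <= x <= Rmax t1 t2 -> in_itv a b x.
Proof.
  intros [H1 H2] [H3 H4] [H5 H6].
  assert (L : Rbar_lt a (Rmin t1 t2)) by (unfold Rmin; now destruct (Rle_dec t1 t2)).
  assert (U : Rbar_lt (Rmax t1 t2) b) by (unfold Rmax; now destruct (Rle_dec t1 t2)).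
  split.
  - now apply Rbar_lt_le_trans with (Finite (Rmin t1 t2)).
  - now apply Rbar_le_lt_trans with (Finite (Rmax t1 t2)).
Qed.

Lemma locally_on a b (P : R -> Prop) t :
  (forall x, in_itv a b x -> P x) -> in_itv a b t -> locally t P.
Proof.
  intros H Ht. apply filter_imp with (1 := H). now apply in_itv_locally.
Qed.

Lemma itv_constant a b (f : R -> R) :
  (forall t, in_itv a b t -> is_derive f t 0) ->
  forall t1 t2, in_itv a b t1 -> in_itv a b t2 -> f t1 = f t2.
Proof.
  intros Hf.
  assert (W : forall t1 t2, in_itv a b t1 -> in_itv a b t2 -> t1 < t2 -> f t1 = f t2).
  { intros t1 t2 H1 H2 H12. apply eq_is_derive; [|exact H12].
    intros t Ht. apply Hf. apply (in_itv_between a b t1 t2); auto.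
    rewrite Rmin_left, Rmax_right; lra. }
  intros t1 t2 H1 H2. destruct (Rtotal_order t1 t2) as [H|[H|H]].
  - now apply W.
  - now subst.
  - symmetry; now apply W.
Qed.

Lemma continuous_pt (f : R -> R) x : continuous f x -> continuity_pt f x.
Proof. intros H. now apply continuity_pt_filterlim. Qed.

Lemma ivt_itv (f : R -> R) t1 t2 y :
  (forall t, Rmin t1 t2 <= t <= Rmax t1 t2 -> continuous f t) ->
  Rmin (f t1) (f t2) <= y <= Rmax (f t1) (f t2) ->
  exists t, Rmin t1 t2 <= t <= Rmax t1 t2 /\ f t = y.
Proof.
  assert (W : forall (f : R -> R) t1 t2,
    (forall t, t1 <= t <= t2 -> continuous f t) -> t1 < t2 ->
    f t1 < y < f t2 -> exists t, t1 <= t <= t2 /\ f t = y).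
  { intros g a b Hg Hab Hy.
    destruct (Ranalysis5.IVT_interv (fun x => g x - y) a b) as [z [Hz Hz0]]; try lra.
    - intros x Hx. apply continuity_pt_minus; [|apply continuity_pt_const; easy].
      now apply continuous_pt, Hg.
    - exists z; split; [exact Hz | lra]. }
  assert (W' : forall t1 t2,
    (forall t, t1 <= t <= t2 -> continuous f t) -> t1 < t2 ->
    Rmin (f t1) (f t2) <= y <= Rmax (f t1) (f t2) ->
    exists t, t1 <= t <= t2 /\ f t = y).
  { intros a b Hf Hab Hy.
    destruct (Req_dec (f a) y) as [Ea|Na]; [exists a; split; [lra|easy]|].
    destruct (Req_dec (f b) y) as [Eb|Nb]; [exists b; split; [lra|easy]|].
    unfold Rmin, Rmax in Hy. destruct (Rle_dec (f a) (f b)).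
    - apply W; auto; lra.
    - destruct (Ranalysis5.IVT_interv (fun x => y - f x) a b) as [z [Hz Hz0]]; try lra.
      + intros x Hx. apply continuity_pt_minus; [apply continuity_pt_const; easy|].
        now apply continuous_pt, Hf.
      + exists z; split; [exact Hz | lra]. }
  intros Hf Hy. destruct (Rtotal_order t1 t2) as [H|[H|H]].
  - rewrite Rmin_left, Rmax_right in * by lra. now apply W'.
  - subst. exists t2. unfold Rmin, Rmax in *.
    destruct (Rle_dec t2 t2), (Rle_dec (f t2) (f t2)); lra.
  - rewrite Rmin_right, Rmax_left by lra. rewrite Rmin_right, Rmax_left in Hf by lra.
    apply W'; auto. rewrite Rmin_comm, Rmax_comm. exact Hy.
Qed.

(** * Functions of class C1 and C2 *)

Lemma is_derive_Rext_loc (f g : R -> R) (t l : R) :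
  locally t (fun x => f x = g x) -> is_derive f t l -> is_derive g t l.
Proof. apply is_derive_ext_loc. Qed.

(** Lets a syntactic differentiation fill in the derivative as an existential variable, which [ring]
    or [field] then compares with the wanted form. *)
Lemma is_derive_eq (f : R -> R) (t l l' : R) :
  is_derive f t l -> l = l' -> is_derive f t l'.
Proof. now intros H <-. Qed.

Lemma is_derive_Rconst (k t : R) : is_derive (fun _ => k) t 0.
Proof. now auto_derive. Qed.

Lemma is_derive_Rplus (f g : R -> R) t a b :
  is_derive f t a -> is_derive g t b -> is_derive (fun x => f x + g x) t (a + b).
Proof. exact (is_derive_plus f g t a b). Qed.

Lemma is_derive_Rminus (f g : R -> R) t a b :
  is_derive f t a -> is_derive g t b -> is_derive (fun x => f x - g x) t (a - b).
Proof. exact (is_derive_minus f g t a b). Qed.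

Lemma is_derive_Rmult (f g : R -> R) t a b :
  is_derive f t a -> is_derive g t b ->
  is_derive (fun x => f x * g x) t (a * g t + f t * b).
Proof. intros Hf Hg. exact (is_derive_mult f g t a b Hf Hg Rmult_comm). Qed.

Lemma is_derive_sqr (f : R -> R) t l :
  is_derive f t l -> is_derive (fun x => f x ^ 2) t (2 * f t * l).
Proof.
  intros H. replace (2 * f t * l) with (INR 2 * l * f t ^ 1) by (simpl; ring).
  now apply is_derive_pow.
Qed.

(** [Derive] is a total function, so its continuity at [t] is meaningful only together with
    derivability on a neighbourhood. *)
Definition C1_at (f : R -> R) (t : R) : Prop :=
  locally t (fun x => ex_derive f x) /\ continuous (Derive f) t.

Lemma C1_at_intro (f f1 : R -> R) t :
  locally t (fun x => is_derive f x (f1 x)) -> continuous f1 t -> C1_at f t.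
Proof.
  intros H Hc. split.
  - apply filter_imp with (2 := H). intros x Hx. now exists (f1 x).
  - apply continuous_ext_loc with (2 := Hc).
    apply filter_imp with (2 := H). intros x Hx. symmetry. now apply is_derive_unique.
Qed.

Lemma C1_at_is_derive f t : C1_at f t -> is_derive f t (Derive f t).
Proof. intros [H _]. apply Derive_correct. now apply locally_singleton in H. Qed.

Lemma C1_at_ex_derive f t : C1_at f t -> ex_derive f t.
Proof. intros [H _]. now apply locally_singleton in H. Qed.

Lemma C1_at_continuous f t : C1_at f t -> continuous f t.
Proof. intros H. apply (ex_derive_continuous f), C1_at_ex_derive, H. Qed.

Lemma C1_at_const (k : R) t : C1_at (fun _ => k) t.
Proof.
  apply C1_at_intro with (fun _ => 0).
  - apply filter_forall. intros x. auto_derive; easy.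
  - apply continuous_const.
Qed.

Lemma C1_at_opp f t : C1_at f t -> C1_at (fun x => - f x) t.
Proof.
  intros Hf. apply C1_at_intro with (fun x => - Derive f x).
  - apply filter_imp with (2 := proj1 Hf). intros x H1. now apply (is_derive_opp f), Derive_correct.
  - apply (continuous_opp (Derive f)), Hf.
Qed.

Lemma C1_at_plus f g t : C1_at f t -> C1_at g t -> C1_at (fun x => f x + g x) t.
Proof.
  intros Hf Hg. apply C1_at_intro with (fun x => Derive f x + Derive g x).
  - apply filter_imp with (2 := filter_and _ _ (proj1 Hf) (proj1 Hg)).
    intros x [H1 H2]. now apply (is_derive_plus f g); apply Derive_correct.
  - apply (continuous_plus (Derive f) (Derive g)); [apply Hf | apply Hg].
Qed.

Lemma C1_at_minus f g t : C1_at f t -> C1_at g t -> C1_at (fun x => f x - g x) t.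
Proof. intros Hf Hg. apply C1_at_plus, C1_at_opp; assumption. Qed.

Lemma continuous_Rmult (f g : R -> R) t :
  continuous f t -> continuous g t -> continuous (fun x => f x * g x) t.
Proof. exact (continuous_mult f g t). Qed.

Lemma continuous_Rplus (f g : R -> R) t :
  continuous f t -> continuous g t -> continuous (fun x => f x + g x) t.
Proof. exact (continuous_plus f g t). Qed.

Lemma continuous_Rminus (f g : R -> R) t :
  continuous f t -> continuous g t -> continuous (fun x => f x - g x) t.
Proof. exact (continuous_minus f g t). Qed.

Lemma C1_at_mult f g t : C1_at f t -> C1_at g t -> C1_at (fun x => f x * g x) t.
Proof.
  intros Hf Hg. apply C1_at_intro with (fun x => Derive f x * g x + f x * Derive g x).
  - apply filter_imp with (2 := filter_and _ _ (proj1 Hf) (proj1 Hg)).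
    intros x [H1 H2].
    apply (is_derive_mult f g); [now apply Derive_correct .. | exact Rmult_comm].
  - apply continuous_Rplus; apply continuous_Rmult;
      try (now apply C1_at_continuous); [apply Hf | apply Hg].
Qed.

Lemma C1_at_sqr f t : C1_at f t -> C1_at (fun x => f x ^ 2) t.
Proof.
  intros Hf. apply C1_at_intro with (fun x => 2 * f x * Derive f x).
  - apply filter_imp with (2 := proj1 Hf). intros x H.
    now apply is_derive_sqr, Derive_correct.
  - apply continuous_Rmult; [|apply Hf].
    apply continuous_Rmult; [apply continuous_const | now apply C1_at_continuous].
Qed.

Lemma locally_neq0 (f : R -> R) t :
  continuous f t -> f t <> 0 -> locally t (fun x => f x <> 0).
Proof. intros Hc H. exact (Hc (fun y => y <> 0) (open_neq 0 (f t) H)). Qed.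

Lemma C1_at_comp (g g1 f : R -> R) t :
  C1_at f t ->
  locally (f t) (fun y => is_derive g y (g1 y)) -> continuous g1 (f t) ->
  C1_at (fun x => g (f x)) t.
Proof.
  intros Hf Hg Hc. pose proof (C1_at_continuous _ _ Hf) as Cf.
  apply C1_at_intro with (fun x => Derive f x * g1 (f x)).
  - apply filter_imp with (2 := filter_and _ _ (proj1 Hf) (Cf _ Hg)).
    intros x [H1 H2]. apply (is_derive_comp g f); [exact H2 | now apply Derive_correct].
  - apply continuous_Rmult; [apply Hf | now apply (continuous_comp f g1)].
Qed.

Lemma C1_at_cos f t : C1_at f t -> C1_at (fun x => cos (f x)) t.
Proof.
  intros Hf. apply C1_at_comp with (fun y => - sin y); [exact Hf | |].
  - apply filter_forall. exact is_derive_cos.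
  - apply (continuous_opp sin), continuous_sin.
Qed.

Lemma C1_at_sin f t : C1_at f t -> C1_at (fun x => sin (f x)) t.
Proof.
  intros Hf. apply C1_at_comp with cos; [exact Hf | |].
  - apply filter_forall. exact is_derive_sin.
  - apply continuous_cos.
Qed.

Lemma continuous_Rinv_id (y : R) : y <> 0 -> continuous Rinv y.
Proof. intros H. apply (continuous_Rinv_comp (fun z => z)); [apply continuous_id | exact H]. Qed.

Lemma C1_at_inv f t : C1_at f t -> f t <> 0 -> C1_at (fun x => / f x) t.
Proof.
  intros Hf H0. apply (C1_at_comp Rinv (fun y => - (/ y * / y))); [exact Hf | |].
  - apply filter_imp with (2 := open_neq 0 (f t) H0).
    intros y Hy. auto_derive; [exact Hy | now field].
  - apply (continuous_opp (fun y => / y * / y)).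
    apply continuous_Rmult; now apply continuous_Rinv_id.
Qed.

Lemma C1_at_div f g t :
  C1_at f t -> C1_at g t -> g t <> 0 -> C1_at (fun x => f x / g x) t.
Proof. intros Hf Hg H0. apply C1_at_mult; [|apply C1_at_inv]; assumption. Qed.

Lemma C1_at_sqrt f t : C1_at f t -> 0 < f t -> C1_at (fun x => sqrt (f x)) t.
Proof.
  intros Hf H0. apply (C1_at_comp sqrt (fun y => / (2 * sqrt y))); [exact Hf | |].
  - apply filter_imp with (2 := open_gt 0 (f t) H0).
    intros y Hy. auto_derive; [exact Hy|].
    assert (sqrt y <> 0) by (apply Rgt_not_eq; now apply sqrt_lt_R0). now field.
  - apply continuous_Rinv_comp.
    + apply continuous_Rmult; [apply continuous_const|].
      apply continuous_sqrt_comp, continuous_id.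
    + assert (0 < sqrt (f t)) by now apply sqrt_lt_R0. lra.
Qed.

Lemma C1_at_ext_loc (f g : R -> R) t :
  locally t (fun x => f x = g x) -> C1_at f t -> C1_at g t.
Proof.
  intros E [H1 H2]. apply C1_at_intro with (Derive f); [|exact H2].
  apply filter_imp with (2 := filter_and _ _ H1 (locally_locally _ _ E)).
  intros x [H Hx]. apply is_derive_ext_loc with (1 := Hx). now apply Derive_correct.
Qed.

(** Serves the converse direction, where the residual, which contains [F''], must be continuous. *)
Definition C2_at (f : R -> R) (t : R) : Prop :=
  locally t (fun x => ex_derive f x) /\ C1_at (Derive f) t.

Lemma C2_at_intro (f f1 : R -> R) t :
  locally t (fun x => is_derive f x (f1 x)) -> C1_at f1 t -> C2_at f t.
Proof.
  intros H Hc. split.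
  - apply filter_imp with (2 := H). intros x Hx. now exists (f1 x).
  - apply C1_at_ext_loc with (2 := Hc).
    apply filter_imp with (2 := H). intros x Hx. symmetry. now apply is_derive_unique.
Qed.

Lemma C2_at_C1_at f t : C2_at f t -> C1_at f t.
Proof. intros [H1 H2]. split; [exact H1 | now apply C1_at_continuous]. Qed.

Lemma C2_at_opp f t : C2_at f t -> C2_at (fun x => - f x) t.
Proof.
  intros Hf. apply C2_at_intro with (fun x => - Derive f x).
  - apply filter_imp with (2 := proj1 Hf). intros x H1. now apply (is_derive_opp f), Derive_correct.
  - apply C1_at_opp, Hf.
Qed.

Lemma C2_at_plus f g t : C2_at f t -> C2_at g t -> C2_at (fun x => f x + g x) t.
Proof.
  intros Hf Hg. apply C2_at_intro with (fun x => Derive f x + Derive g x).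
  - apply filter_imp with (2 := filter_and _ _ (proj1 Hf) (proj1 Hg)).
    intros x [H1 H2]. now apply is_derive_Rplus; apply Derive_correct.
  - apply C1_at_plus; [apply Hf | apply Hg].
Qed.

Lemma C2_at_minus f g t : C2_at f t -> C2_at g t -> C2_at (fun x => f x - g x) t.
Proof. intros Hf Hg. apply C2_at_plus, C2_at_opp; assumption. Qed.

Lemma C2_at_mult f g t : C2_at f t -> C2_at g t -> C2_at (fun x => f x * g x) t.
Proof.
  intros Hf Hg. apply C2_at_intro with (fun x => Derive f x * g x + f x * Derive g x).
  - apply filter_imp with (2 := filter_and _ _ (proj1 Hf) (proj1 Hg)).
    intros x [H1 H2]. now apply is_derive_Rmult; apply Derive_correct.
  - apply C1_at_plus; apply C1_at_mult;
      try (now apply C2_at_C1_at); [apply Hf | apply Hg].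
Qed.

Lemma C2_at_cos f t : C2_at f t -> C2_at (fun x => cos (f x)) t.
Proof.
  intros Hf. apply C2_at_intro with (fun x => Derive f x * - sin (f x)).
  - apply filter_imp with (2 := proj1 Hf). intros x H.
    apply (is_derive_comp cos f); [apply is_derive_cos | now apply Derive_correct].
  - apply C1_at_mult; [apply Hf|]. now apply C1_at_opp, C1_at_sin, C2_at_C1_at.
Qed.

Lemma C2_at_sin f t : C2_at f t -> C2_at (fun x => sin (f x)) t.
Proof.
  intros Hf. apply C2_at_intro with (fun x => Derive f x * cos (f x)).
  - apply filter_imp with (2 := proj1 Hf). intros x H.
    apply (is_derive_comp sin f); [apply is_derive_sin | now apply Derive_correct].
  - apply C1_at_mult; [apply Hf|]. now apply C1_at_cos, C2_at_C1_at.
Qed.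

Lemma C2_at_ext_loc (f g : R -> R) t :
  locally t (fun x => f x = g x) -> C2_at f t -> C2_at g t.
Proof.
  intros E [H1 H2]. apply C2_at_intro with (Derive f); [|exact H2].
  apply filter_imp with (2 := filter_and _ _ H1 (locally_locally _ _ E)).
  intros x [H Hx]. apply is_derive_Rext_loc with (1 := Hx). now apply Derive_correct.
Qed.

(** * Polar coordinates *)

Lemma polar_angle (p q : R) : p ^ 2 + q ^ 2 = 1 -> exists phi, p = cos phi /\ q = sin phi.
Proof.
  intros H. assert (Hp : -1 <= p <= 1) by nra.
  assert (E : sqrt (1 - p²) = Rabs q).
  { rewrite <- sqrt_Rsqr_abs. f_equal. unfold Rsqr. lra. }
  destruct (Rle_dec 0 q) as [Hq|Hq].
  - exists (acos p). now rewrite cos_acos, sin_acos, E, Rabs_pos_eq.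
  - exists (- acos p).
    rewrite cos_neg, sin_neg, cos_acos, sin_acos, E, Rabs_left by lra. split; lra.
Qed.

(* The angle is a primitive of (x y' - y x') / (x^2 + y^2). *)
Lemma polar_lift a b (x y : R -> R) :
  (forall t, in_itv a b t -> C1_at x t /\ C1_at y t /\ 0 < x t ^ 2 + y t ^ 2) ->
  exists phi : R -> R, forall t, in_itv a b t ->
    ex_derive phi t /\
    x t = sqrt (x t ^ 2 + y t ^ 2) * cos (phi t) /\
    y t = sqrt (x t ^ 2 + y t ^ 2) * sin (phi t).
Proof.
  intros H.
  (* The primitive needs a base point; on an empty interval any function will do. *)
  destruct (classic (exists t0, in_itv a b t0)) as [[t0 H0]|N];
    [|exists (fun _ => 0); intros t Ht; elim N; now exists t].
  pose (r := fun t => sqrt (x t ^ 2 + y t ^ 2)).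
  assert (Hr : forall t, in_itv a b t -> 0 < r t).
  { intros t Ht. apply sqrt_lt_R0, H, Ht. }
  assert (Hr2 : forall t, in_itv a b t -> r t ^ 2 = x t ^ 2 + y t ^ 2).
  { intros t Ht. unfold r. apply pow2_sqrt. destruct (H t Ht) as [_ [_ P]]. lra. }
  destruct (polar_angle (x t0 / r t0) (y t0 / r t0)) as [phi0 [Ec Es]].
  { pose proof (Hr t0 H0). pose proof (Hr2 t0 H0) as E2.
    replace ((x t0 / r t0) ^ 2 + (y t0 / r t0) ^ 2)
      with ((x t0 ^ 2 + y t0 ^ 2) / r t0 ^ 2) by (field; lra).
    rewrite <- E2. field. lra. }
  pose (dphi := fun t => (x t * Derive y t - y t * Derive x t) / (x t ^ 2 + y t ^ 2)).
  assert (Cd : forall t, in_itv a b t -> continuous dphi t).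
  { intros t Ht. destruct (H t Ht) as [Cx [Cy P]].
    pose proof (C1_at_continuous _ _ Cx). pose proof (C1_at_continuous _ _ Cy).
    apply continuous_Rmult.
    - apply continuous_Rminus; apply continuous_Rmult; auto; [apply Cy | apply Cx].
    - apply continuous_Rinv_comp; [|lra].
      apply (C1_at_continuous (fun t => x t ^ 2 + y t ^ 2)).
      now apply C1_at_plus; apply C1_at_sqr. }
  pose (phi := fun t => phi0 + RInt dphi t0 t).
  assert (Dphi : forall t, in_itv a b t -> is_derive phi t (dphi t)).
  { intros t Ht. unfold phi.
    replace (dphi t) with (0 + dphi t) by ring.
    apply (is_derive_plus (fun _ => phi0)); [auto_derive; easy|].
    apply is_derive_RInt with t0; [|now apply Cd].
    apply locally_on with (2 := Ht). intros z Hz.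
    apply (RInt_correct dphi), (ex_RInt_continuous dphi).
    intros s Hs. apply Cd. now apply (in_itv_between a b t0 z). }
  assert (Dr : forall t, in_itv a b t ->
    is_derive r t ((x t * Derive x t + y t * Derive y t) / r t)).
  { intros t Ht. destruct (H t Ht) as [Cx [Cy P]]. pose proof (Hr t Ht) as Pr.
    replace ((x t * Derive x t + y t * Derive y t) / r t)
      with ((2 * x t * Derive x t + 2 * y t * Derive y t) / (2 * r t)) by (field; lra).
    apply (is_derive_sqrt (fun t => x t ^ 2 + y t ^ 2)); [|exact P].
    apply (is_derive_plus (fun t => x t ^ 2) (fun t => y t ^ 2));
      now apply is_derive_sqr, C1_at_is_derive. }
  assert (P0 : phi t0 = phi0) by (unfold phi; rewrite RInt_point; unfold zero; simpl; ring).
  assert (Er : forall t, sqrt (x t ^ 2 + y t ^ 2) = r t) by easy.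
  clearbody phi r.
  (* With [z = x + i y] both parts of [z exp(-i phi) / r] are constant. *)
  assert (Kc : forall t, in_itv a b t ->
    (x t * cos (phi t) + y t * sin (phi t)) / r t = 1 /\
    (- x t * sin (phi t) + y t * cos (phi t)) / r t = 0).
  { intros t Ht.
    pose proof (Hr t0 H0) as Q0. pose proof (sin2_cos2 phi0) as T0. unfold Rsqr in T0.
    assert (X0 : x t0 = r t0 * cos phi0) by (rewrite <- Ec; field; lra).
    assert (Y0 : y t0 = r t0 * sin phi0) by (rewrite <- Es; field; lra).
    split.
    - transitivity ((x t0 * cos (phi t0) + y t0 * sin (phi t0)) / r t0).
      + apply (itv_constant a b
          (fun t => (x t * cos (phi t) + y t * sin (phi t)) / r t)); auto.
        intros z Hz. destruct (H z Hz) as [Cx [Cy P]]. pose proof (Hr z Hz) as Pr.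
        pose proof (Dphi z Hz) as D1. pose proof (Dr z Hz) as D2. pose proof (Hr2 z Hz) as E2.
        auto_derive.
        * repeat split; auto using C1_at_ex_derive; try (now eexists; eassumption); lra.
        * change (fun x0 : R => phi x0) with phi. change (fun x0 : R => r x0) with r.
          change (fun x0 : R => x x0) with x. change (fun x0 : R => y x0) with y.
          rewrite (is_derive_unique _ _ _ D1), (is_derive_unique _ _ _ D2).
          unfold dphi. rewrite <- E2.
          field_simplify_eq; [|lra].
          replace (r z ^ 4) with ((r z ^ 2) ^ 2) by ring. rewrite ?E2. ring.
      + rewrite P0, X0, Y0. field_simplify_eq; [|lra].
        nra.
    - transitivity ((- x t0 * sin (phi t0) + y t0 * cos (phi t0)) / r t0).
      + apply (itv_constant a b
          (fun t => (- x t * sin (phi t) + y t * cos (phi t)) / r t)); auto.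
        intros z Hz. destruct (H z Hz) as [Cx [Cy P]]. pose proof (Hr z Hz) as Pr.
        pose proof (Dphi z Hz) as D1. pose proof (Dr z Hz) as D2. pose proof (Hr2 z Hz) as E2.
        auto_derive.
        * repeat split; auto using C1_at_ex_derive; try (now eexists; eassumption); lra.
        * change (fun x0 : R => phi x0) with phi. change (fun x0 : R => r x0) with r.
          change (fun x0 : R => x x0) with x. change (fun x0 : R => y x0) with y.
          rewrite (is_derive_unique _ _ _ D1), (is_derive_unique _ _ _ D2).
          unfold dphi. rewrite <- E2.
          field_simplify_eq; [|lra].
          replace (r z ^ 4) with ((r z ^ 2) ^ 2) by ring. rewrite ?E2. ring.
      + rewrite P0, X0, Y0. field. lra. }
  exists phi. intros t Ht. rewrite Er. destruct (Kc t Ht) as [K1 K2].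
  pose proof (Hr t Ht) as Pr. pose proof (sin2_cos2 (phi t)) as T. unfold Rsqr in T.
  assert (L1 : x t * cos (phi t) + y t * sin (phi t) = r t).
  { rewrite <- (Rmult_1_l (r t)), <- K1. field. lra. }
  assert (L2 : - x t * sin (phi t) + y t * cos (phi t) = 0).
  { rewrite <- (Rmult_0_l (r t)), <- K2. field. lra. }
  split; [|split].
  - exists (dphi t). now apply Dphi.
  (* Rotating the pair [(r, 0)] of [L1] and [L2] back by [phi] recovers [x] and [y]. *)
  - transitivity ((x t * cos (phi t) + y t * sin (phi t)) * cos (phi t)
      - (- x t * sin (phi t) + y t * cos (phi t)) * sin (phi t)).
    + transitivity (x t * (sin (phi t) * sin (phi t) + cos (phi t) * cos (phi t)));
        [rewrite T | ]; ring.
    + rewrite L1, L2. ring.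
  - transitivity ((x t * cos (phi t) + y t * sin (phi t)) * sin (phi t)
      + (- x t * sin (phi t) + y t * cos (phi t)) * cos (phi t)).
    + transitivity (y t * (sin (phi t) * sin (phi t) + cos (phi t) * cos (phi t)));
        [rewrite T | ]; ring.
    + rewrite L1, L2. ring.
Qed.

(** * First integrals and the residual of the equations of motion *)

Lemma sum_n_1 (f : nat -> R) : sum_n f 1 = f 0%nat + f 1%nat.
Proof. now rewrite sum_Sn, sum_O. Qed.

Lemma entry_mul2 M N i j :
  (i < 2)%nat -> (j < 2)%nat ->
  entry (mul2 M N) i j = entry M i 0 * entry N 0 j + entry M i 1 * entry N 1 j.
Proof.
  intros Hi Hj. unfold mul2, Mmult. unfold entry at 1.
  rewrite coeff_mat_bij by assumption. exact (sum_n_1 _).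
Qed.

Lemma lt2_ind (P : nat -> Prop) : P 0%nat -> P 1%nat -> forall i, (i < 2)%nat -> P i.
Proof. intros H0 H1 [|[|i]] Hi; [easy|easy|lia]. Qed.

Lemma Gsq_entries M :
  Gsq M = entry M 0 0 ^ 2 + entry M 0 1 ^ 2 + entry M 1 0 ^ 2 + entry M 1 1 ^ 2.
Proof. unfold Gsq. rewrite !sum_n_1. ring. Qed.

(** The square removes the absolute value, so both signs of the determinant are treated at once. *)
Lemma potential_2 U0 M : det2 M <> 0 -> potential U0 2 M = U0 / det2 M.
Proof.
  intros H. unfold potential. rewrite Rpower_Ropp.
  replace 2 with (INR 2) by reflexivity.
  rewrite Rpower_pow by now apply Rabs_pos_lt.
  rewrite pow2_abs. now field.
Qed.

(** The determinant is affine in each single entry; [al] is the cofactor of that entry, and the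
    chain rule for [U0 / det] does the rest. *)
Lemma partial_potential_2 U0 M i j al be :
  (forall x, det2 (replace_entry M i j x) = al * x + be) ->
  det2 M = al * entry M i j + be -> det2 M <> 0 ->
  partial (potential U0 2) i j M = - U0 * al / det2 M ^ 2.
Proof.
  intros Ha E H. unfold partial. apply is_derive_unique.
  rewrite E in *.
  apply is_derive_Rext_loc with (fun x => U0 / (al * x + be)).
  - assert (Hl : locally (entry M i j) (fun x => al * x + be <> 0)).
    { apply (locally_neq0 (fun x => al * x + be)); [|exact H].
      apply (ex_derive_continuous (fun x => al * x + be)). now auto_derive. }
    apply filter_imp with (2 := Hl). intros x Hx.
    now rewrite potential_2, Ha; [|rewrite Ha].
  - auto_derive; [exact H | now field].
Qed.

(** The left-hand side of [is_motion] with its parameters substituted. The factors 1 are kept so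
    that the two agree by conversion. *)
Definition residual (U0 omega : R) (F : R -> mat2) (i j : nat) (t : R) : R :=
  Fddot F i j t + partial (potential U0 2) i j (F t)
  + 2 * omega * sum_n (fun m => entry Lmat i m * Fdot F m j t) 1
  - 1 * omega ^ 2 * entry (mul2 (mat2_of 1 0 0 1) (F t)) i j.

Lemma residual_entries U0 omega F t :
  det2 (F t) <> 0 ->
  residual U0 omega F 0 0 t =
    Fddot F 0 0 t - U0 * entry (F t) 1 1 / det2 (F t) ^ 2
    - 2 * omega * Fdot F 1 0 t - omega ^ 2 * entry (F t) 0 0 /\
  residual U0 omega F 0 1 t =
    Fddot F 0 1 t + U0 * entry (F t) 1 0 / det2 (F t) ^ 2
    - 2 * omega * Fdot F 1 1 t - omega ^ 2 * entry (F t) 0 1 /\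
  residual U0 omega F 1 0 t =
    Fddot F 1 0 t + U0 * entry (F t) 0 1 / det2 (F t) ^ 2
    + 2 * omega * Fdot F 0 0 t - omega ^ 2 * entry (F t) 1 0 /\
  residual U0 omega F 1 1 t =
    Fddot F 1 1 t - U0 * entry (F t) 0 0 / det2 (F t) ^ 2
    + 2 * omega * Fdot F 0 1 t - omega ^ 2 * entry (F t) 1 1.
Proof.
  intros H. unfold residual. rewrite !sum_n_1, !entry_mul2 by lia.
  change (entry Lmat 0 0) with 0. change (entry Lmat 0 1) with (-1).
  change (entry Lmat 1 0) with 1. change (entry Lmat 1 1) with 0.
  change (entry (mat2_of 1 0 0 1) 0 0) with 1. change (entry (mat2_of 1 0 0 1) 0 1) with 0.
  change (entry (mat2_of 1 0 0 1) 1 0) with 0. change (entry (mat2_of 1 0 0 1) 1 1) with 1.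
  set (M := F t) in *.
  assert (D : forall i j x, det2 (replace_entry M i j x) =
    (if andb (Nat.eqb 0 i) (Nat.eqb 0 j) then x else entry M 0 0) *
    (if andb (Nat.eqb 1 i) (Nat.eqb 1 j) then x else entry M 1 1) -
    (if andb (Nat.eqb 0 i) (Nat.eqb 1 j) then x else entry M 0 1) *
    (if andb (Nat.eqb 1 i) (Nat.eqb 0 j) then x else entry M 1 0)) by easy.
  repeat split.
  - rewrite (partial_potential_2 U0 M 0 0 (entry M 1 1) (- entry M 0 1 * entry M 1 0));
      [field; exact H | intros x; rewrite D; simpl; ring | unfold det2; ring | exact H].
  - rewrite (partial_potential_2 U0 M 0 1 (- entry M 1 0) (entry M 0 0 * entry M 1 1));
      [field; exact H | intros x; rewrite D; simpl; ring | unfold det2; ring | exact H].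
  - rewrite (partial_potential_2 U0 M 1 0 (- entry M 0 1) (entry M 0 0 * entry M 1 1));
      [field; exact H | intros x; rewrite D; simpl; ring | unfold det2; ring | exact H].
  - rewrite (partial_potential_2 U0 M 1 1 (entry M 0 0) (- entry M 0 1 * entry M 1 0));
      [field; exact H | intros x; rewrite D; simpl; ring | unfold det2; ring | exact H].
Qed.

Definition twice_derivable (F : R -> mat2) (t : R) : Prop :=
  forall i j : nat, (i < 2)%nat -> (j < 2)%nat ->
    ex_derive (fun x => entry (F x) i j) t /\ ex_derive (Fdot F i j) t.

Lemma is_derive_entry F t i j :
  twice_derivable F t -> (i < 2)%nat -> (j < 2)%nat ->
  is_derive (fun x => entry (F x) i j) t (Fdot F i j t).
Proof. intros H Hi Hj. exact (Derive_correct _ _ (proj1 (H i j Hi Hj))). Qed.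

Lemma is_derive_Fdot F t i j :
  twice_derivable F t -> (i < 2)%nat -> (j < 2)%nat ->
  is_derive (Fdot F i j) t (Fddot F i j t).
Proof. intros H Hi Hj. exact (Derive_correct _ _ (proj2 (H i j Hi Hj))). Qed.

(** The order of the cases matters. Hypotheses come first, so that [det2 (F x)] and [Gsq (F x)] can
    be treated as atoms; constant factors come before general products, which would also match
    them. *)
Ltac derive_step :=
  match goal with
  | H : is_derive ?f ?t _ |- is_derive ?f ?t _ => exact H
  | |- is_derive (fun x => x) _ _ => apply (is_derive_id (K := R_AbsRing))
  | |- is_derive (fun x => / @?f x) _ _ => apply (is_derive_inv f); [| assumption]
  | |- is_derive (fun x => @?f x + @?g x) _ _ => apply (is_derive_Rplus f g)
  | |- is_derive (fun x => @?f x - @?g x) _ _ => apply (is_derive_Rminus f g)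
  | |- is_derive (fun x => ?k * @?g x) _ _ =>
      apply (is_derive_Rmult (fun _ => k) g); [apply is_derive_Rconst |]
  | |- is_derive (fun x => @?f x * @?g x) _ _ => apply (is_derive_Rmult f g)
  | |- is_derive (fun x => @?f x ^ 2) _ _ => apply (is_derive_sqr f)
  | |- is_derive (fun x => entry _ _ _) _ _ => apply is_derive_entry; [eassumption | lia ..]
  | |- is_derive (fun x => Fdot _ _ _ _) _ _ => apply is_derive_Fdot; [eassumption | lia ..]
  end.

Lemma is_derive_det F t :
  twice_derivable F t ->
  is_derive (fun x => det2 (F x)) t
    (Fdot F 0 0 t * entry (F t) 1 1 + entry (F t) 0 0 * Fdot F 1 1 t
     - Fdot F 0 1 t * entry (F t) 1 0 - entry (F t) 0 1 * Fdot F 1 0 t).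
Proof.
  intros H. unfold det2. eapply is_derive_eq; [repeat derive_step | ring].
Qed.

Definition moment (F : R -> mat2) (t : R) : R :=
  entry (F t) 0 0 * Fdot F 0 0 t + entry (F t) 0 1 * Fdot F 0 1 t
  + entry (F t) 1 0 * Fdot F 1 0 t + entry (F t) 1 1 * Fdot F 1 1 t.

Lemma is_derive_Gsq F t :
  twice_derivable F t ->
  is_derive (fun x => Gsq (F x)) t (2 * moment F t).
Proof.
  intros H.
  apply is_derive_Rext_loc with (fun x => entry (F x) 0 0 ^ 2 + entry (F x) 0 1 ^ 2
    + entry (F x) 1 0 ^ 2 + entry (F x) 1 1 ^ 2).
  { apply filter_forall. intros x. now rewrite Gsq_entries. }
  unfold moment. eapply is_derive_eq; [repeat derive_step | ring].
Qed.

(** The power of the residual: the Coriolis force is orthogonal to [F'], while the potential and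
    centrifugal forces are gradients of the two remaining terms of the energy. *)
Lemma is_derive_energy U0 omega F t :
  twice_derivable F t -> det2 (F t) <> 0 ->
  is_derive (energy U0 2 omega F) t
    (residual U0 omega F 0 0 t * Fdot F 0 0 t + residual U0 omega F 0 1 t * Fdot F 0 1 t
     + residual U0 omega F 1 0 t * Fdot F 1 0 t + residual U0 omega F 1 1 t * Fdot F 1 1 t).
Proof.
  intros H Hd. pose proof (is_derive_det F t H) as Dd.
  pose proof (is_derive_Gsq F t H) as DG.
  destruct (residual_entries U0 omega F t Hd) as [-> [-> [-> ->]]].
  apply is_derive_Rext_loc with (fun x =>
    / 2 * (Fdot F 0 0 x ^ 2 + Fdot F 0 1 x ^ 2 + Fdot F 1 0 x ^ 2 + Fdot F 1 1 x ^ 2)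
    + U0 * / det2 (F x) - / 2 * omega ^ 2 * Gsq (F x)).
  { assert (Hl : locally t (fun x => det2 (F x) <> 0)).
    { apply (locally_neq0 (fun x => det2 (F x))); [|exact Hd].
      apply (ex_derive_continuous (fun x => det2 (F x))). eexists; exact Dd. }
    apply filter_imp with (2 := Hl). intros x Hx. unfold energy.
    rewrite potential_2, !sum_n_1 by exact Hx. unfold Rdiv. ring. }
  eapply is_derive_eq.
  - repeat derive_step.
  - unfold moment. field. exact Hd.
Qed.

(** The Coriolis force contributes [2 omega] times [moment], that is [omega G']; the term [omega G]
    of [A] accounts for it. In the same way [- 2 omega det F] accounts for it in [B]. *)
Lemma is_derive_integralA U0 omega F t :
  twice_derivable F t -> det2 (F t) <> 0 ->
  is_derive (integralA omega F) t
    (residual U0 omega F 1 0 t * entry (F t) 0 0 + residual U0 omega F 1 1 t * entry (F t) 0 1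
     - residual U0 omega F 0 0 t * entry (F t) 1 0 - residual U0 omega F 0 1 t * entry (F t) 1 1).
Proof.
  intros H Hd. pose proof (is_derive_Gsq F t H) as DG.
  destruct (residual_entries U0 omega F t Hd) as [-> [-> [-> ->]]].
  unfold integralA. eapply is_derive_eq.
  - repeat derive_step.
  - unfold moment, det2 in *. field. exact Hd.
Qed.

Lemma is_derive_integralB U0 omega F t :
  twice_derivable F t -> det2 (F t) <> 0 ->
  is_derive (integralB omega F) t
    (residual U0 omega F 0 1 t * entry (F t) 0 0 + residual U0 omega F 1 1 t * entry (F t) 1 0
     - residual U0 omega F 0 0 t * entry (F t) 0 1 - residual U0 omega F 1 0 t * entry (F t) 1 1).
Proof.
  intros H Hd. pose proof (is_derive_det F t H) as Dd.
  destruct (residual_entries U0 omega F t Hd) as [-> [-> [-> ->]]].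
  unfold integralB. eapply is_derive_eq.
  - repeat derive_step.
  - unfold det2 in *. field. exact Hd.
Qed.

(* The potential is homogeneous of degree -2, so the virial of its gradient is -2 U. *)
Lemma is_derive_moment U0 omega F t :
  twice_derivable F t -> det2 (F t) <> 0 ->
  is_derive (moment F) t
    (2 * (energy U0 2 omega F t + omega * integralA omega F t)
     + (residual U0 omega F 0 0 t * entry (F t) 0 0 + residual U0 omega F 0 1 t * entry (F t) 0 1
        + residual U0 omega F 1 0 t * entry (F t) 1 0 + residual U0 omega F 1 1 t * entry (F t) 1 1)).
Proof.
  intros H Hd.
  destruct (residual_entries U0 omega F t Hd) as [-> [-> [-> ->]]].
  unfold moment. eapply is_derive_eq; [repeat derive_step|].
  unfold energy, integralA. rewrite potential_2, !sum_n_1, Gsq_entries by exact Hd.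
  unfold det2 in *. field. exact Hd.
Qed.

(* The vectors [F], [J F], [F J] and [F'] are independent; the first two factors of [k]
   are four times the squared norms of the conformal and anticonformal parts of [F]. *)
Lemma orthogonal_frame (f00 f01 f10 f11 g00 g01 g10 g11 q00 q01 q10 q11 : R) :
  q00 * f00 + q01 * f01 + q10 * f10 + q11 * f11 = 0 ->
  q10 * f00 + q11 * f01 - q00 * f10 - q01 * f11 = 0 ->
  q01 * f00 + q11 * f10 - q00 * f01 - q10 * f11 = 0 ->
  q00 * g00 + q01 * g01 + q10 * g10 + q11 * g11 = 0 ->
  let G := f00 ^ 2 + f01 ^ 2 + f10 ^ 2 + f11 ^ 2 in
  let d := f00 * f11 - f01 * f10 in
  let dG := 2 * (f00 * g00 + f01 * g01 + f10 * g10 + f11 * g11) in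
  let dd := g00 * f11 + f00 * g11 - g01 * f10 - f01 * g10 in
  let k := (G + 2 * d) * (G - 2 * d) * (G * dd - dG * d) in
  k <> 0 -> q00 = 0 /\ q01 = 0 /\ q10 = 0 /\ q11 = 0.
Proof.
  intros H1 H2 H3 H4 G d dG dd k Hk.
  set (p1 := f00 + f11). set (p2 := f10 - f01). set (m1 := f00 - f11). set (m2 := f01 + f10).
  set (a1 := q00 + q11). set (a2 := q10 - q01). set (b1 := q00 - q11). set (b2 := q01 + q10).
  assert (EP : G + 2 * d = p1 ^ 2 + p2 ^ 2) by (unfold G, d, p1, p2; ring).
  assert (EM : G - 2 * d = m1 ^ 2 + m2 ^ 2) by (unfold G, d, m1, m2; ring).
  assert (PA : a2 * p1 = a1 * p2) by (unfold a1, a2, p1, p2; lra).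
  (* Difference and sum of [H2] and [H3]: the conformal part [(a1, a2)] of [q] is parallel to the
     part [(p1, p2)] of [f], and the anticonformal part [(b1, b2)] is parallel to [(m1, m2)]. With
     [S], which is [H1], a single unknown [al] remains. *)
  assert (MB : b2 * m1 = b1 * m2) by (unfold b1, b2, m1, m2; lra).
  set (al := a1 * p1 + a2 * p2). set (be := b1 * m1 + b2 * m2).
  assert (S : al + be = 0).
  { unfold al, be, a1, a2, b1, b2, p1, p2, m1, m2. lra. }
  assert (C1 : forall x1 x2 y1 y2, x2 * y1 = x1 * y2 ->
    x1 * (y1 ^ 2 + y2 ^ 2) = (x1 * y1 + x2 * y2) * y1).
  { intros x1 x2 y1 y2 E. transitivity (x1 * y1 ^ 2 + y2 * (x1 * y2)); [ring|].
    rewrite <- E. ring. }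
  assert (C2 : forall x1 x2 y1 y2, x2 * y1 = x1 * y2 ->
    x2 * (y1 ^ 2 + y2 ^ 2) = (x1 * y1 + x2 * y2) * y2).
  { intros x1 x2 y1 y2 E. transitivity (y1 * (x2 * y1) + x2 * y2 ^ 2); [ring|].
    rewrite E. ring. }
  assert (A1 : a1 * (p1 ^ 2 + p2 ^ 2) = al * p1) by now apply C1.
  assert (A2 : a2 * (p1 ^ 2 + p2 ^ 2) = al * p2) by now apply C2.
  assert (B1 : b1 * (m1 ^ 2 + m2 ^ 2) = be * m1) by now apply C1.
  assert (B2 : b2 * (m1 ^ 2 + m2 ^ 2) = be * m2) by now apply C2.
  (* Orthogonality to [g] becomes one equation for [al]. Its coefficient comes from
     [p . g = (G + 2 d)' / 2] and [m . g = (G - 2 d)' / 2] on the respective parts, which combine to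
     [2 (G dd - dG d)]. *)
  assert (K : k * al = 0).
  { assert (W : (p1 ^ 2 + p2 ^ 2) * (m1 ^ 2 + m2 ^ 2) *
       (a1 * (g00 + g11) + a2 * (g10 - g01) + b1 * (g00 - g11) + b2 * (g01 + g10)) = 0).
    { apply Rmult_eq_0_compat_l. unfold a1, a2, b1, b2. lra. }
    assert (W' : (m1 ^ 2 + m2 ^ 2) * (al * (p1 * (g00 + g11) + p2 * (g10 - g01)))
      + (p1 ^ 2 + p2 ^ 2) * (be * (m1 * (g00 - g11) + m2 * (g01 + g10))) = 0).
    { rewrite <- W.
      transitivity ((m1 ^ 2 + m2 ^ 2) * ((al * p1) * (g00 + g11) + (al * p2) * (g10 - g01))
      + (p1 ^ 2 + p2 ^ 2) * ((be * m1) * (g00 - g11) + (be * m2) * (g01 + g10))); [ring|].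
      rewrite <- A1, <- A2, <- B1, <- B2. ring. }
    replace be with (- al) in W' by lra.
    assert (Z : al * (G * dd - dG * d) = 0).
    { assert (al * (2 * (G * dd - dG * d)) = 0); [|lra].
      rewrite <- W'. unfold G, dd, dG, d, p1, p2, m1, m2. ring. }
    unfold k. rewrite <- (Rmult_0_r ((G + 2 * d) * (G - 2 * d))), <- Z. ring. }
  assert (al = 0) by (destruct (Rmult_integral _ _ K); [contradiction | assumption]).
  assert (be = 0) by lra.
  assert (NP : p1 ^ 2 + p2 ^ 2 <> 0).
  { intros Z. apply Hk. unfold k. rewrite EP, Z. ring. }
  assert (NM : m1 ^ 2 + m2 ^ 2 <> 0).
  { intros Z. apply Hk. unfold k. rewrite EM, Z. ring. }
  assert (C : forall x y z, y <> 0 -> x * y = 0 * z -> x = 0).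
  { intros x y z Hy E. rewrite Rmult_0_l in E. destruct (Rmult_integral _ _ E); tauto. }
  rewrite H in A1, A2. rewrite H0 in B1, B2.
  apply C in A1, A2, B1, B2; auto. unfold a1, a2, b1, b2 in *. lra.
Qed.

(** * The variables s, u, v, w *)

Lemma svd_entries v d1 d2 w :
  let M := mul2 (mul2 (rot v) (mat2_of d1 0 0 d2)) (rot w) in
  entry M 0 0 = d1 * (cos v * cos w) - d2 * (sin v * sin w) /\
  entry M 0 1 = - d1 * (cos v * sin w) - d2 * (sin v * cos w) /\
  entry M 1 0 = d1 * (sin v * cos w) + d2 * (cos v * sin w) /\
  entry M 1 1 = - d1 * (sin v * sin w) + d2 * (cos v * cos w).
Proof.
  intros M. unfold M. rewrite !entry_mul2 by lia.
  unfold rot, mat2_of, entry, coeff_mat; simpl. repeat split; ring.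
Qed.

Lemma mat2_ext (M N : mat2) :
  entry M 0 0 = entry N 0 0 -> entry M 0 1 = entry N 0 1 ->
  entry M 1 0 = entry N 1 0 -> entry M 1 1 = entry N 1 1 -> M = N.
Proof.
  destruct M as [[a [b []]] [[c [d []]] []]], N as [[a' [b' []]] [[c' [d' []]] []]].
  unfold entry, coeff_mat; simpl. now intros -> -> -> ->.
Qed.

Lemma new_variables_entries c d F s u v w t :
  new_variables c d F s u v w -> in_itv c d t ->
  let d1 := s t * cos (u t) in let d2 := s t * sin (u t) in
  entry (F t) 0 0 = d1 * (cos (v t) * cos (w t)) - d2 * (sin (v t) * sin (w t)) /\
  entry (F t) 0 1 = - d1 * (cos (v t) * sin (w t)) - d2 * (sin (v t) * cos (w t)) /\
  entry (F t) 1 0 = d1 * (sin (v t) * cos (w t)) + d2 * (cos (v t) * sin (w t)) /\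
  entry (F t) 1 1 = - d1 * (sin (v t) * sin (w t)) + d2 * (cos (v t) * cos (w t)).
Proof.
  intros H Ht. destruct (H t Ht) as [_ [_ [_ [_ ->]]]]. apply svd_entries.
Qed.

(* [Fdot = rot v (m_ij) rot w], the middle factor being [D' + v' J D + w' D J]
   with [D = diag (d1, d2)]. *)
Lemma new_variables_Fdot c d F s u v w t :
  new_variables c d F s u v w -> in_itv c d t ->
  let d1 := s t * cos (u t) in let d2 := s t * sin (u t) in
  let m00 := Derive s t * cos (u t) - Derive u t * d2 in
  let m11 := Derive s t * sin (u t) + Derive u t * d1 in
  let m01 := - (Derive v t * d2 + Derive w t * d1) in
  let m10 := Derive v t * d1 + Derive w t * d2 in
  Fdot F 0 0 t = (cos (v t) * m00 - sin (v t) * m10) * cos (w t)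
               + (cos (v t) * m01 - sin (v t) * m11) * sin (w t) /\
  Fdot F 0 1 t = - (cos (v t) * m00 - sin (v t) * m10) * sin (w t)
               + (cos (v t) * m01 - sin (v t) * m11) * cos (w t) /\
  Fdot F 1 0 t = (sin (v t) * m00 + cos (v t) * m10) * cos (w t)
               + (sin (v t) * m01 + cos (v t) * m11) * sin (w t) /\
  Fdot F 1 1 t = - (sin (v t) * m00 + cos (v t) * m10) * sin (w t)
               + (sin (v t) * m01 + cos (v t) * m11) * cos (w t).
Proof.
  intros H Ht. cbv zeta. destruct (H t Ht) as [Hs [Hu [Hv [Hw _]]]].
  assert (E : forall i j g, (forall x, in_itv c d x -> entry (F x) i j = g x) ->
    Fdot F i j t = Derive g t).
  { intros i j g Hg. apply Derive_ext_loc. apply locally_on with (2 := Ht). exact Hg. }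
  rewrite (E 0%nat 0%nat _ (fun x Hx => proj1 (new_variables_entries _ _ _ _ _ _ _ x H Hx))).
  rewrite (E 0%nat 1%nat _ (fun x Hx =>
    proj1 (proj2 (new_variables_entries _ _ _ _ _ _ _ x H Hx)))).
  rewrite (E 1%nat 0%nat _ (fun x Hx =>
    proj1 (proj2 (proj2 (new_variables_entries _ _ _ _ _ _ _ x H Hx))))).
  rewrite (E 1%nat 1%nat _ (fun x Hx =>
    proj2 (proj2 (proj2 (new_variables_entries _ _ _ _ _ _ _ x H Hx))))).
  repeat split; apply is_derive_unique; (auto_derive; [repeat split; assumption |]);
    change (fun x : R => s x) with s; change (fun x : R => u x) with u;
    change (fun x : R => v x) with v; change (fun x : R => w x) with w; ring.
Qed.

Lemma cos_2a_sqr x : cos (2 * x) ^ 2 = 1 - sin (2 * x) ^ 2.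
Proof. pose proof (sin2_cos2 (2 * x)) as T. unfold Rsqr in T. lra. Qed.

Lemma rot_sum_sqr a b x :
  (a * cos x + b * sin x) ^ 2 + (- a * sin x + b * cos x) ^ 2 = a ^ 2 + b ^ 2.
Proof.
  pose proof (sin2_cos2 x) as T. unfold Rsqr in T.
  transitivity ((a ^ 2 + b ^ 2) * (sin x * sin x + cos x * cos x)); [ring|].
  rewrite T. ring.
Qed.

(** * Invariants of [F] and first integrals in the new variables *)

Section Invariants.

Variables (c d : Rbar) (F : R -> mat2) (s u v w : R -> R) (t : R).
Hypothesis H : new_variables c d F s u v w.
Hypothesis Ht : in_itv c d t.

Lemma Gsq_new_variables : Gsq (F t) = s t ^ 2.
Proof.
  rewrite Gsq_entries.
  destruct (new_variables_entries _ _ _ _ _ _ _ t H Ht) as [-> [-> [-> ->]]].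
  pose proof (sin2_cos2 (u t)) as Tu. pose proof (sin2_cos2 (v t)) as Tv.
  pose proof (sin2_cos2 (w t)) as Tw. unfold Rsqr in *.
  (* Each Pythagorean sum is inserted as a factor 1, which turns the claim into a polynomial
     identity. *)
  transitivity (s t ^ 2 * (sin (u t) * sin (u t) + cos (u t) * cos (u t))
    * (sin (v t) * sin (v t) + cos (v t) * cos (v t))
    * (sin (w t) * sin (w t) + cos (w t) * cos (w t))); [ring|].
  rewrite Tu, Tv, Tw. ring.
Qed.

Lemma det2_new_variables : 2 * det2 (F t) = s t ^ 2 * sin (2 * u t).
Proof.
  unfold det2.
  destruct (new_variables_entries _ _ _ _ _ _ _ t H Ht) as [-> [-> [-> ->]]].
  rewrite sin_2a. pose proof (sin2_cos2 (v t)) as Tv.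
  pose proof (sin2_cos2 (w t)) as Tw. unfold Rsqr in *.
  transitivity (s t ^ 2 * (2 * sin (u t) * cos (u t))
    * (sin (v t) * sin (v t) + cos (v t) * cos (v t))
    * (sin (w t) * sin (w t) + cos (w t) * cos (w t))); [ring|].
  rewrite Tv, Tw. ring.
Qed.

Lemma kinetic_new_variables :
  Fdot F 0 0 t ^ 2 + Fdot F 0 1 t ^ 2 + Fdot F 1 0 t ^ 2 + Fdot F 1 1 t ^ 2 =
  Derive s t ^ 2 + s t ^ 2 * (Derive u t ^ 2 + Derive v t ^ 2 + Derive w t ^ 2
    + 2 * Derive v t * Derive w t * sin (2 * u t)).
Proof.
  destruct (new_variables_Fdot _ _ _ _ _ _ _ t H Ht) as [-> [-> [-> ->]]].
  (* The entries are regrouped by rows: each row of [F'] is a pair rotated by [w], so [w] drops out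
     before [v] does. *)
  rewrite !Rplus_assoc, <- (Rplus_assoc _ _ (_ + _)), !rot_sum_sqr.
  rewrite sin_2a. pose proof (sin2_cos2 (v t)) as Tv.
  pose proof (sin2_cos2 (u t)) as Tu. unfold Rsqr in *.
  transitivity ((Derive s t ^ 2 * (sin (u t) * sin (u t) + cos (u t) * cos (u t))
    + s t ^ 2 * ((Derive u t ^ 2 + Derive v t ^ 2 + Derive w t ^ 2)
         * (sin (u t) * sin (u t) + cos (u t) * cos (u t))
    + 2 * Derive v t * Derive w t * (2 * sin (u t) * cos (u t))))
    * (sin (v t) * sin (v t) + cos (v t) * cos (v t))); [ring|].
  rewrite Tu, Tv. ring.
Qed.

Lemma integralA_new_variables omega :
  integralA omega F t =
  s t ^ 2 * (Derive v t + omega + Derive w t * sin (2 * u t)).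
Proof.
  unfold integralA. rewrite Gsq_new_variables.
  destruct (new_variables_Fdot _ _ _ _ _ _ _ t H Ht) as [-> [-> [-> ->]]].
  destruct (new_variables_entries _ _ _ _ _ _ _ t H Ht) as [-> [-> [-> ->]]].
  rewrite sin_2a. pose proof (sin2_cos2 (v t)) as Tv. pose proof (sin2_cos2 (w t)) as Tw.
  pose proof (sin2_cos2 (u t)) as Tu. unfold Rsqr in *.
  transitivity (s t ^ 2 * (Derive v t * (sin (u t) * sin (u t) + cos (u t) * cos (u t))
    + Derive w t * (2 * sin (u t) * cos (u t)))
    * (sin (v t) * sin (v t) + cos (v t) * cos (v t))
    * (sin (w t) * sin (w t) + cos (w t) * cos (w t)) + omega * s t ^ 2); [ring|].
  rewrite Tu, Tv, Tw. ring.
Qed.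

Lemma integralB_new_variables omega :
  integralB omega F t =
  - (s t ^ 2 * ((Derive v t + omega) * sin (2 * u t) + Derive w t)).
Proof.
  unfold integralB.
  replace (2 * omega * det2 (F t)) with (omega * (2 * det2 (F t))) by ring.
  rewrite det2_new_variables.
  destruct (new_variables_Fdot _ _ _ _ _ _ _ t H Ht) as [-> [-> [-> ->]]].
  destruct (new_variables_entries _ _ _ _ _ _ _ t H Ht) as [-> [-> [-> ->]]].
  rewrite sin_2a. pose proof (sin2_cos2 (v t)) as Tv. pose proof (sin2_cos2 (w t)) as Tw.
  pose proof (sin2_cos2 (u t)) as Tu. unfold Rsqr in *.
  transitivity (- (s t ^ 2 * (Derive w t * (sin (u t) * sin (u t) + cos (u t) * cos (u t))
    + Derive v t * (2 * sin (u t) * cos (u t)))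
    * (sin (v t) * sin (v t) + cos (v t) * cos (v t))
    * (sin (w t) * sin (w t) + cos (w t) * cos (w t)))
    - omega * (s t ^ 2 * (2 * sin (u t) * cos (u t)))); [ring|].
  rewrite Tu, Tv, Tw. ring.
Qed.

Hypothesis det_neq0 : det2 (F t) <> 0.

Lemma s_neq0 : s t <> 0.
Proof.
  intros E. apply det_neq0. pose proof det2_new_variables as D. rewrite E in D. lra.
Qed.

Lemma sin_2u_neq0 : sin (2 * u t) <> 0.
Proof.
  intros E. apply det_neq0. pose proof det2_new_variables as D. rewrite E in D. lra.
Qed.

Hypothesis cos_neq0 : cos (2 * u t) <> 0.

Lemma v_rate_new_variables omega :
  Derive v t = v_rate omega (integralA omega F t) (integralB omega F t) s u t.
Proof.
  pose proof s_neq0. unfold v_rate. rewrite integralA_new_variables, integralB_new_variables.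
  pose proof (cos_2a_sqr (u t)) as T.
  assert (1 - sin (2 * u t) ^ 2 <> 0) by (rewrite <- T; now apply pow_nonzero).
  rewrite T. field. now split.
Qed.

Lemma w_rate_new_variables omega :
  Derive w t = w_rate (integralA omega F t) (integralB omega F t) s u t.
Proof.
  pose proof s_neq0. unfold w_rate. rewrite integralA_new_variables, integralB_new_variables.
  pose proof (cos_2a_sqr (u t)) as T.
  assert (1 - sin (2 * u t) ^ 2 <> 0) by (rewrite <- T; now apply pow_nonzero).
  rewrite T. field. now split.
Qed.

(** [E + omega A] is the energy in the inertial frame, where [v' + omega] replaces [v']. With
    [S = sin 2u] and [M] the symmetric matrix with rows [(1, S)] and [(S, 1)], the vector [(A, -B)]
    is [s^2 M (v' + omega, w')], and the angular part of the kinetic energy is the quadratic form of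
    [M]. Written in [A] and [B] it becomes the form of the inverse of [M], whose denominator is
    [det M = cos^2 2u]. *)
Lemma energy_new_variables U0 omega :
  2 * s t ^ 2 * (energy U0 2 omega F t + omega * integralA omega F t) =
  (s t * Derive s t) ^ 2 + (s t ^ 2 * Derive u t) ^ 2 + 4 * U0 / sin (2 * u t)
  + (integralA omega F t ^ 2 + integralB omega F t ^ 2
     + 2 * integralA omega F t * integralB omega F t * sin (2 * u t)) / cos (2 * u t) ^ 2.
Proof.
  pose proof s_neq0. pose proof sin_2u_neq0.
  unfold energy. rewrite potential_2, !sum_n_1 by exact det_neq0.
  replace (det2 (F t)) with (s t ^ 2 * sin (2 * u t) / 2)
    by (rewrite <- det2_new_variables; field).
  rewrite <- (Rplus_assoc _ (Fdot F 1 0 t ^ 2)), kinetic_new_variables, Gsq_new_variables.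
  rewrite integralA_new_variables, integralB_new_variables.
  pose proof (cos_2a_sqr (u t)) as T.
  assert (1 - sin (2 * u t) ^ 2 <> 0) by (rewrite <- T; now apply pow_nonzero).
  rewrite T. field. now repeat split.
Qed.

End Invariants.

(** * From the system to the reduced equation *)

Lemma is_motion_residual U0 omega a b F :
  is_motion U0 2 omega (2 * omega) 1 1 a b F <->
  forall t, in_itv a b t ->
    det2 (F t) <> 0 /\ twice_derivable F t /\
    residual U0 omega F 0 0 t = 0 /\ residual U0 omega F 0 1 t = 0 /\
    residual U0 omega F 1 0 t = 0 /\ residual U0 omega F 1 1 t = 0.
Proof.
  split; intros H t Ht; destruct (H t Ht) as [Hd H'].
  - split; [exact Hd|]. split.
    + intros i j Hi Hj. destruct (H' i j Hi Hj) as [H1 [H2 _]]. now split.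
    + repeat split; (eapply proj2, proj2, H'; lia).
  - destruct H' as [T [Q0 [Q1 [Q2 Q3]]]]. split; [exact Hd|]. intros i j Hi Hj.
    destruct (T i j Hi Hj) as [T1 T2]. split; [exact T1|]. split; [exact T2|].
    clear T T1 T2. revert j Hj. revert i Hi.
    refine (lt2_ind _ _ _); refine (lt2_ind _ _ _); assumption.
Qed.

Lemma motion_first_integrals U0 omega a b F :
  is_motion U0 2 omega (2 * omega) 1 1 a b F ->
  exists E A B k0 k1, first_integrals U0 2 omega a b F E A B k0 k1.
Proof.
  rewrite is_motion_residual. intros H.
  destruct (classic (exists t0, in_itv a b t0)) as [[t0 H0]|N];
    [|exists 0, 0, 0, 0, 0; intros t Ht; elim N; now exists t].
  assert (CE : forall t, in_itv a b t -> energy U0 2 omega F t = energy U0 2 omega F t0).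
  { intros t Ht. apply (itv_constant a b); auto. intros x Hx.
    destruct (H x Hx) as [Hd [T [Q0 [Q1 [Q2 Q3]]]]].
    eapply is_derive_eq; [now apply is_derive_energy|]. rewrite Q0, Q1, Q2, Q3. ring. }
  assert (CA : forall t, in_itv a b t -> integralA omega F t = integralA omega F t0).
  { intros t Ht. apply (itv_constant a b); auto. intros x Hx.
    destruct (H x Hx) as [Hd [T [Q0 [Q1 [Q2 Q3]]]]].
    eapply is_derive_eq; [now apply (is_derive_integralA U0)|]. rewrite Q0, Q1, Q2, Q3. ring. }
  assert (CB : forall t, in_itv a b t -> integralB omega F t = integralB omega F t0).
  { intros t Ht. apply (itv_constant a b); auto. intros x Hx.
    destruct (H x Hx) as [Hd [T [Q0 [Q1 [Q2 Q3]]]]].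
    eapply is_derive_eq; [now apply (is_derive_integralB U0)|]. rewrite Q0, Q1, Q2, Q3. ring. }
  set (E := energy U0 2 omega F t0) in *. set (A := integralA omega F t0) in *.
  set (B := integralB omega F t0) in *. set (K := E + omega * A).
  (* [moment] is [G'/2], so [C1] and then [C0] integrate [G'' = 4 K] twice; the constants of
     integration are [k1] and [k0]. *)
  assert (C1 : forall t, in_itv a b t ->
    2 * moment F t - 4 * K * t = 2 * moment F t0 - 4 * K * t0).
  { intros t Ht. apply (itv_constant a b (fun t => 2 * moment F t - 4 * K * t)); auto.
    intros x Hx. destruct (H x Hx) as [Hd [T [Q0 [Q1 [Q2 Q3]]]]].
    pose proof (is_derive_moment U0 omega F x T Hd) as DM.
    pose proof (is_derive_id x) as DI.
    eapply is_derive_eq; [repeat derive_step|].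
    rewrite Q0, Q1, Q2, Q3, (CE x Hx), (CA x Hx). unfold K, one; simpl. ring. }
  set (k1 := 2 * moment F t0 - 4 * K * t0) in *.
  assert (C0 : forall t, in_itv a b t ->
    Gsq (F t) - 2 * K * t ^ 2 - k1 * t = Gsq (F t0) - 2 * K * t0 ^ 2 - k1 * t0).
  { intros t Ht.
    apply (itv_constant a b (fun t => Gsq (F t) - 2 * K * t ^ 2 - k1 * t)); auto.
    intros x Hx. destruct (H x Hx) as [Hd [T _]].
    pose proof (is_derive_Gsq F x T) as DG.
    pose proof (is_derive_id x) as DI.
    eapply is_derive_eq; [repeat derive_step|].
    rewrite <- (C1 x Hx). unfold one; simpl. ring. }
  exists E, A, B, (Gsq (F t0) - 2 * K * t0 ^ 2 - k1 * t0), k1.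
  intros t Ht. repeat split; auto. fold K. rewrite <- (C0 t Ht). ring.
Qed.

(* [F] is the sum of a conformal part [p] and an anticonformal part [q], of moduli
   [(d1 + d2) / 2] and [(d1 - d2) / 2] and angles [v + w] and [v - w]; both are nonzero
   under the hypothesis, so the angles lift. *)
Lemma new_variables_exist c d F :
  (forall t, in_itv c d t -> twice_derivable F t) ->
  (forall t, in_itv c d t -> 2 * Rabs (det2 (F t)) < Gsq (F t)) ->
  exists s u v w, new_variables c d F s u v w /\
    forall t, in_itv c d t -> cos (2 * u t) <> 0.
Proof.
  intros T HG.
  assert (CF : forall t i j, in_itv c d t -> (i < 2)%nat -> (j < 2)%nat ->
    C1_at (fun x => entry (F x) i j) t).
  { intros t i j Ht Hi Hj. apply C1_at_intro with (Fdot F i j).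
    - apply locally_on with (2 := Ht). intros x Hx. apply is_derive_entry; auto.
    - apply (ex_derive_continuous (Fdot F i j)), (T t Ht i j Hi Hj). }
  set (p1 := fun t => (entry (F t) 0 0 + entry (F t) 1 1) * / 2).
  set (p2 := fun t => (entry (F t) 1 0 - entry (F t) 0 1) * / 2).
  set (q1 := fun t => (entry (F t) 0 0 - entry (F t) 1 1) * / 2).
  set (q2 := fun t => (entry (F t) 0 1 + entry (F t) 1 0) * / 2).
  assert (Cp1 : forall t, in_itv c d t -> C1_at p1 t).
  { intros t Ht. apply C1_at_mult, C1_at_const. apply C1_at_plus; apply CF; auto. }
  assert (Cp2 : forall t, in_itv c d t -> C1_at p2 t).
  { intros t Ht. apply C1_at_mult, C1_at_const. apply C1_at_minus; apply CF; auto. }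
  assert (Cq1 : forall t, in_itv c d t -> C1_at q1 t).
  { intros t Ht. apply C1_at_mult, C1_at_const. apply C1_at_minus; apply CF; auto. }
  assert (Cq2 : forall t, in_itv c d t -> C1_at q2 t).
  { intros t Ht. apply C1_at_mult, C1_at_const. apply C1_at_plus; apply CF; auto. }
  (* [4 (p1^2 + p2^2) = G + 2 det] and [4 (q1^2 + q2^2) = G - 2 det]; the hypothesis makes both
     positive. *)
  assert (Pp : forall t, in_itv c d t -> 0 < p1 t ^ 2 + p2 t ^ 2).
  { intros t Ht. specialize (HG t Ht). pose proof (Rle_abs (- det2 (F t))) as Ha.
    rewrite Rabs_Ropp in Ha. rewrite Gsq_entries in HG. unfold det2, p1, p2 in *. nra. }
  assert (Pq : forall t, in_itv c d t -> 0 < q1 t ^ 2 + q2 t ^ 2).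
  { intros t Ht. specialize (HG t Ht). pose proof (Rle_abs (det2 (F t))) as Ha.
    rewrite Gsq_entries in HG. unfold det2, q1, q2 in *. nra. }
  destruct (polar_lift c d p1 p2) as [al Hal]; [auto|].
  destruct (polar_lift c d q1 q2) as [be Hbe]; [auto|].
  set (r1 := fun t => sqrt (p1 t ^ 2 + p2 t ^ 2)) in *.
  set (r2 := fun t => sqrt (q1 t ^ 2 + q2 t ^ 2)) in *.
  assert (Cr1 : forall t, in_itv c d t -> C1_at r1 t /\ 0 < r1 t).
  { intros t Ht. split; [|now apply sqrt_lt_R0, Pp].
    apply (C1_at_sqrt (fun t => p1 t ^ 2 + p2 t ^ 2)); [|now apply Pp].
    apply C1_at_plus; apply C1_at_sqr; auto. }
  assert (Cr2 : forall t, in_itv c d t -> C1_at r2 t /\ 0 < r2 t).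
  { intros t Ht. split; [|now apply sqrt_lt_R0, Pq].
    apply (C1_at_sqrt (fun t => q1 t ^ 2 + q2 t ^ 2)); [|now apply Pq].
    apply C1_at_plus; apply C1_at_sqr; auto. }
  (* Signed singular values: [d1 d2 = r1^2 - r2^2 = det F] with [d1] positive, so [d2] carries the
     sign of the determinant. Their polar coordinates are [s] and [u]. *)
  set (d1 := fun t => r1 t + r2 t). set (d2 := fun t => r1 t - r2 t).
  assert (Cd : forall t, in_itv c d t -> C1_at d1 t /\ C1_at d2 t /\ 0 < d1 t ^ 2 + d2 t ^ 2).
  { intros t Ht. destruct (Cr1 t Ht) as [C1 P1], (Cr2 t Ht) as [C2 P2].
    split; [now apply C1_at_plus|]. split; [now apply C1_at_minus|].
    unfold d1, d2. nra. }
  destruct (polar_lift c d d1 d2 Cd) as [u Hu].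
  set (s := fun t => sqrt (d1 t ^ 2 + d2 t ^ 2)) in *.
  assert (Cs : forall t, in_itv c d t -> C1_at s t).
  { intros t Ht. destruct (Cd t Ht) as [C1 [C2 P]].
    apply (C1_at_sqrt (fun t => d1 t ^ 2 + d2 t ^ 2)); [|exact P].
    apply C1_at_plus; now apply C1_at_sqr. }
  exists s, u, (fun t => (al t + be t) * / 2), (fun t => (al t - be t) * / 2). split.
  - intros t Ht. destruct (Hal t Ht) as [Da [A1 A2]], (Hbe t Ht) as [Db [B1 B2]].
    destruct (Hu t Ht) as [Du [U1 U2]].
    split; [now apply C1_at_ex_derive, Cs|]. split; [exact Du|].
    split; [now auto_derive|]. split; [now auto_derive|].
    change (sqrt (d1 t ^ 2 + d2 t ^ 2)) with (s t) in *.
    rewrite <- U1, <- U2.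
    change (sqrt (p1 t ^ 2 + p2 t ^ 2)) with (r1 t) in *.
    change (sqrt (q1 t ^ 2 + q2 t ^ 2)) with (r2 t) in *.
    set (v := (al t + be t) * / 2). set (w := (al t - be t) * / 2).
    replace (al t) with (v + w) in A1, A2 by (unfold v, w; field).
    replace (be t) with (v - w) in B1, B2 by (unfold v, w; field).
    rewrite cos_plus in A1. rewrite sin_plus in A2.
    rewrite cos_minus in B1. rewrite sin_minus in B2.
    destruct (svd_entries v (d1 t) (d2 t) w) as [E0 [E1 [E2 E3]]].
    unfold p1, p2, q1, q2, d1, d2 in *.
    apply mat2_ext; [rewrite E0 | rewrite E1 | rewrite E2 | rewrite E3]; lra.
  - intros t Ht E. destruct (Hu t Ht) as [Du [U1 U2]].
    change (sqrt (d1 t ^ 2 + d2 t ^ 2)) with (s t) in *.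
    destruct (Cr1 t Ht) as [_ P1], (Cr2 t Ht) as [_ P2].
    rewrite cos_2a in E.
    (* [s^2 cos 2u = d1^2 - d2^2 = 4 r1 r2], which is positive. *)
    assert (4 * (r1 t * r2 t) = 0); [|nra].
    transitivity (d1 t ^ 2 - d2 t ^ 2); [unfold d1, d2; ring|].
    rewrite U1, U2. transitivity (s t ^ 2 * (cos (u t) * cos (u t) - sin (u t) * sin (u t)));
      [ring | rewrite E; ring].
Qed.

Lemma Derive_sqr_quadratic a b (s : R -> R) K k0 k1 t :
  (forall x, in_itv a b x -> s x ^ 2 = 2 * K * x ^ 2 + k1 * x + k0) ->
  in_itv a b t -> ex_derive s t -> s t * Derive s t = 2 * K * t + k1 / 2.
Proof.
  intros H Ht Hs.
  assert (E : 2 * s t * Derive s t = 4 * K * t + k1); [|lra].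
  assert (D1 := is_derive_sqr s t _ (Derive_correct s t Hs)).
  assert (D2 : is_derive (fun x => s x ^ 2) t (4 * K * t + k1)).
  { apply is_derive_Rext_loc with (fun x => 2 * K * x ^ 2 + k1 * x + k0).
    - apply locally_on with (2 := Ht). intros x Hx. symmetry. now apply H.
    - auto_derive; [easy | ring]. }
  rewrite <- (is_derive_unique _ _ _ D1). exact (is_derive_unique _ _ _ D2).
Qed.

(** [E] need not be the energy here. With the right [E] the last term vanishes and the squared
    reduced equation remains; conversely, the reduced equation forces that term to vanish and so
    identifies [E]. The value of [integralA] at [t] is frozen in the quadratic law, so that the law
    can be differentiated without knowing that [A] is conserved. *)
Lemma radicand_new_variables U0 omega c d F s u v w E k0 k1 t :
  new_variables c d F s u v w -> in_itv c d t ->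
  det2 (F t) <> 0 -> cos (2 * u t) <> 0 ->
  (forall x, in_itv c d x ->
     s x ^ 2 = 2 * (E + omega * integralA omega F t) * x ^ 2 + k1 * x + k0) ->
  radicand U0 (integralA omega F t) (integralB omega F t)
    (radicandD omega E (integralA omega F t) k0 k1) (u t)
  = (s t ^ 2 * Derive u t) ^ 2 + 2 * s t ^ 2 * (E - energy U0 2 omega F t).
Proof.
  intros H Ht Hd Hc HG.
  pose proof (energy_new_variables c d F s u v w t H Ht Hd Hc U0 omega) as EN.
  pose proof (Derive_sqr_quadratic _ _ _ _ _ _ t HG Ht (proj1 (H t Ht))) as DS.
  unfold radicand, radicandD.
  set (A := integralA omega F t) in *. set (B := integralB omega F t) in *.
  set (V := 4 * U0 / _) in *. set (W := _ / _ ^ 2) in *.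
  transitivity (2 * (E + omega * A) * s t ^ 2 - (s t * Derive s t) ^ 2 - V - W).
  - rewrite DS, (HG t Ht). field.
  - lra.
Qed.

(** [reduced_ode] may choose its sign anew at each time, so nothing is lost by squaring; the sign is
    that of [u']. *)
Lemma reduced_ode_iff U0 A B D s u t :
  s t <> 0 -> ex_derive u t ->
  reduced_ode U0 A B D s u t <-> radicand U0 A B D (u t) = (s t ^ 2 * Derive u t) ^ 2.
Proof.
  intros Hs Hu. assert (Ps : 0 < s t ^ 2) by (apply pow2_gt_0; exact Hs). split.
  - intros [P [sg [Hsg Du]]]. rewrite (is_derive_unique _ _ _ Du).
    replace (s t ^ 2 * (sg * (/ s t ^ 2 * sqrt (radicand U0 A B D (u t)))))
      with (sg * sqrt (radicand U0 A B D (u t))) by (field; exact Hs).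
    rewrite Rpow_mult_distr, pow2_sqrt by exact P.
    destruct Hsg as [-> | ->]; ring.
  - intros E. unfold reduced_ode. rewrite E. split; [apply pow2_ge_0|].
    rewrite <- (Rsqr_pow2 (s t ^ 2 * Derive u t)), sqrt_Rsqr_abs, Rabs_mult,
      (Rabs_pos_eq (s t ^ 2)) by lra.
    destruct (Rle_dec 0 (Derive u t)) as [Hp|Hn].
    + exists 1. split; [now left|]. rewrite Rabs_pos_eq by exact Hp.
      apply is_derive_eq with (Derive u t); [now apply Derive_correct | field; exact Hs].
    + exists (-1). split; [now right|]. rewrite Rabs_left by lra.
      apply is_derive_eq with (Derive u t); [now apply Derive_correct | field; exact Hs].
Qed.

Lemma C1_at_rates omega A B s u t :
  C1_at s t -> C1_at u t -> s t <> 0 -> cos (2 * u t) <> 0 ->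
  C1_at (v_rate omega A B s u) t /\ C1_at (w_rate A B s u) t.
Proof.
  intros Cs Cu Hs Hc.
  assert (C2u : C1_at (fun x => 2 * u x) t) by (apply C1_at_mult; [apply C1_at_const | exact Cu]).
  assert (CD : C1_at (fun x => s x ^ 2 * cos (2 * u x) ^ 2) t).
  { apply C1_at_mult; apply C1_at_sqr; [exact Cs | now apply C1_at_cos]. }
  assert (HD : s t ^ 2 * cos (2 * u t) ^ 2 <> 0).
  { apply Rmult_integral_contrapositive_currified; now apply pow_nonzero. }
  split.
  - unfold v_rate. apply C1_at_minus; [|apply C1_at_const].
    apply (C1_at_div (fun x => A + B * sin (2 * u x)) (fun x => s x ^ 2 * cos (2 * u x) ^ 2));
      [|exact CD | exact HD].
    apply C1_at_plus; [apply C1_at_const|].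
    apply C1_at_mult; [apply C1_at_const | now apply C1_at_sin].
  - unfold w_rate.
    apply (C1_at_div (fun x => - (B + A * sin (2 * u x))) (fun x => s x ^ 2 * cos (2 * u x) ^ 2));
      [|exact CD | exact HD].
    apply (C1_at_opp (fun x => B + A * sin (2 * u x))).
    apply C1_at_plus; [apply C1_at_const|].
    apply C1_at_mult; [apply C1_at_const | now apply C1_at_sin].
Qed.

Lemma C1_at_radicand U0 A B D y :
  sin (2 * y) <> 0 -> cos (2 * y) <> 0 -> C1_at (radicand U0 A B D) y.
Proof.
  intros Hs Hc.
  assert (Cid : C1_at (fun x => 2 * x) y).
  { apply C1_at_intro with (fun _ => 2).
    - apply filter_forall. intros x. auto_derive; [easy | ring].
    - apply continuous_const. }
  unfold radicand. apply C1_at_minus; [apply C1_at_minus|].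
  - apply C1_at_const.
  - apply C1_at_div; [apply C1_at_const | now apply C1_at_sin | exact Hs].
  - apply (C1_at_div (fun x => A ^ 2 + B ^ 2 + 2 * A * B * sin (2 * x))
            (fun x => cos (2 * x) ^ 2)).
    + apply C1_at_plus; [apply C1_at_const|].
      apply C1_at_mult; [apply C1_at_const | now apply C1_at_sin].
    + now apply C1_at_sqr, C1_at_cos.
    + now apply pow_nonzero.
Qed.

(** Differentiating [|F|^2 = s^2] and [2 det F = s^2 sin 2u] in both sets of variables expresses
    [s'] and [u'] through [F] and [F']. *)
Lemma Derive_invariants c d F s u v w t :
  new_variables c d F s u v w -> in_itv c d t -> twice_derivable F t ->
  moment F t = s t * Derive s t /\
  2 * (Fdot F 0 0 t * entry (F t) 1 1 + entry (F t) 0 0 * Fdot F 1 1 t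
     - Fdot F 0 1 t * entry (F t) 1 0 - entry (F t) 0 1 * Fdot F 1 0 t)
  = 2 * s t * Derive s t * sin (2 * u t) + s t ^ 2 * (2 * Derive u t * cos (2 * u t)).
Proof.
  intros H Ht T. destruct (H t Ht) as [Hs [Hu _]]. split.
  - assert (2 * moment F t = 2 * s t * Derive s t); [|lra].
    rewrite <- (is_derive_unique _ _ _ (is_derive_Gsq F t T)). apply is_derive_unique.
    apply is_derive_Rext_loc with (fun x => s x ^ 2).
    + apply locally_on with (2 := Ht). intros y Hy. symmetry.
      now apply (Gsq_new_variables c d F s u v w).
    + now apply is_derive_sqr, Derive_correct.
  - set (dd := _ - _ - _). rewrite <- (is_derive_unique (fun x => 2 * det2 (F x)) t (2 * dd)).
    + apply is_derive_unique.
      apply is_derive_Rext_loc with (fun x => s x ^ 2 * sin (2 * u x)).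
      * apply locally_on with (2 := Ht). intros y Hy. symmetry.
        now apply (det2_new_variables c d F s u v w).
      * apply (is_derive_Rmult (fun x => s x ^ 2) (fun x => sin (2 * u x))).
        -- now apply is_derive_sqr, Derive_correct.
        -- auto_derive; [exact Hu | change (fun x : R => u x) with u; ring].
    + apply is_derive_eq with (0 * det2 (F t) + 2 * dd); [|ring].
      apply (is_derive_Rmult (fun _ => 2) (fun x => det2 (F x)));
        [apply is_derive_Rconst | now apply is_derive_det].
Qed.

(* [u'] is continuous because [sin 2u = 2 det F / |F|^2] is continuously differentiable. *)
Lemma continuous_Derive_u c d F s u v w t :
  new_variables c d F s u v w ->
  (forall x, in_itv c d x -> twice_derivable F x /\ s x <> 0 /\ cos (2 * u x) <> 0) ->
  in_itv c d t -> continuous (Derive u) t.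
Proof.
  intros H HT Ht.
  set (dd := fun x => Fdot F 0 0 x * entry (F x) 1 1 + entry (F x) 0 0 * Fdot F 1 1 x
     - Fdot F 0 1 x * entry (F x) 1 0 - entry (F x) 0 1 * Fdot F 1 0 x).
  assert (E : forall x, in_itv c d x ->
    Derive u x = (dd x - moment F x * sin (2 * u x)) * / (s x ^ 2 * cos (2 * u x))).
  { intros x Hx. destruct (H x Hx) as [Hs [Hu _]]. destruct (HT x Hx) as [T [Ns Nc]].
    destruct (Derive_invariants c d F s u v w x H Hx T) as [D1 D2]. fold (dd x) in D2.
    replace (dd x) with (moment F x * sin (2 * u x) + s x ^ 2 * (Derive u x * cos (2 * u x)))
      by (rewrite D1; lra).
    field. now split. }
  apply continuous_ext_loc with
    (fun x => (dd x - moment F x * sin (2 * u x)) * / (s x ^ 2 * cos (2 * u x))).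
  { apply locally_on with (2 := Ht). intros x Hx. symmetry. now apply E. }
  destruct (HT t Ht) as [T [Ns Nc]]. destruct (H t Ht) as [Hs [Hu _]].
  assert (Cu : continuous (fun x => 2 * u x) t).
  { apply continuous_Rmult; [apply continuous_const | exact (ex_derive_continuous u t Hu)]. }
  apply continuous_Rmult.
  - apply continuous_Rminus.
    + apply (ex_derive_continuous dd). eexists. unfold dd. repeat derive_step.
    + apply continuous_Rmult; [|exact (continuous_comp _ sin _ Cu (continuous_sin _))].
      apply (ex_derive_continuous (moment F)). eexists. unfold moment. repeat derive_step.
  - apply continuous_Rinv_comp.
    + apply continuous_Rmult; [|exact (continuous_comp _ cos _ Cu (continuous_cos _))].
      apply (ex_derive_continuous (fun x => s x ^ 2)). now auto_derive.
    + apply Rmult_integral_contrapositive_currified; [now apply pow_nonzero | exact Nc].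
Qed.

(** Turns the sign chosen separately at each time into one sign on the whole interval, by the
    intermediate value theorem. *)
Lemma nonvanishing_sign a b (f : R -> R) :
  (forall t, in_itv a b t -> continuous f t /\ f t <> 0) ->
  exists sigma, is_sign sigma /\ forall t, in_itv a b t -> 0 < sigma * f t.
Proof.
  intros H.
  destruct (classic (exists t0, in_itv a b t0)) as [[t0 H0]|N];
    [|exists 1; split; [now left | intros t Ht; elim N; now exists t]].
  assert (S : forall t, in_itv a b t -> 0 < f t0 * f t).
  { intros t Ht. apply Rnot_le_lt. intros Hle.
    destruct (ivt_itv f t0 t 0) as [z [Hz Ez]].
    - intros x Hx. apply H. now apply (in_itv_between a b t0 t).
    - unfold Rmin, Rmax. destruct (Rle_dec (f t0) (f t)); nra.
    - apply (in_itv_between a b t0 t z H0 Ht) in Hz. now apply (proj2 (H z Hz)). }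
  pose proof (S t0 H0) as S0.
  destruct (Rlt_dec 0 (f t0)) as [P|P].
  - exists 1. split; [now left|]. intros t Ht. specialize (S t Ht). nra.
  - exists (-1). split; [now right|]. intros t Ht. specialize (S t Ht). nra.
Qed.

Lemma u_quadrature_of_reduced U0 A B D c d s u :
  (forall t, in_itv c d t ->
     ex_derive s t /\ s t <> 0 /\ ex_derive u t /\ continuous (Derive u) t /\
     sin (2 * u t) <> 0 /\ cos (2 * u t) <> 0 /\
     0 < radicand U0 A B D (u t) /\
     radicand U0 A B D (u t) = (s t ^ 2 * Derive u t) ^ 2) ->
  u_quadrature U0 A B D s u c d.
Proof.
  intros H. set (f := radicand U0 A B D) in *.
  destruct (nonvanishing_sign c d (Derive u)) as [sg [Hsg Sg]].
  { intros t Ht. destruct (H t Ht) as [_ [_ [_ [C [_ [_ [P E]]]]]]]. split; [exact C|].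
    intros Z. rewrite Z in E. lra. }
  exists sg. split; [exact Hsg|]. intros t0 t H0 Ht.
  assert (B' : forall x, Rmin t0 t <= x <= Rmax t0 t -> in_itv c d x).
  { intros x. now apply in_itv_between. }
  assert (Cs2 : forall x, in_itv c d x -> continuous (fun x => / s x ^ 2) x).
  { intros x Hx. destruct (H x Hx) as [C [N _]].
    apply continuous_Rinv_comp; [|now apply pow_nonzero].
    apply (ex_derive_continuous (fun x => s x ^ 2)). now auto_derive. }
  assert (Cf : forall x, in_itv c d x -> continuous (fun y => / sqrt (f y)) (u x)).
  { intros x Hx. destruct (H x Hx) as [_ [_ [_ [_ [S [C [P _]]]]]]].
    apply continuous_Rinv_comp.
    - apply continuous_sqrt_comp. now apply C1_at_continuous, C1_at_radicand.
    - apply Rgt_not_eq. now apply sqrt_lt_R0. }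
  (* The reduced equation with its variables separated; [sg] makes [s^2 u'] positive, so it is the
     root and not its opposite. *)
  assert (Du : forall x, in_itv c d x -> Derive u x * / sqrt (f (u x)) = sg * / s x ^ 2).
  { intros x Hx. destruct (H x Hx) as [_ [N [_ [_ [_ [_ [P E]]]]]]]. fold (f (u x)) in E.
    assert (Ps : 0 < s x ^ 2) by (apply pow2_gt_0; exact N).
    assert (Q : sqrt (f (u x)) = s x ^ 2 * (sg * Derive u x)).
    { rewrite E. rewrite <- (sqrt_pow2 (s x ^ 2 * (sg * Derive u x))).
      - f_equal. destruct Hsg as [-> | ->]; ring.
      - apply Rmult_le_pos; [lra | left; now apply Sg]. }
    specialize (Sg x Hx). rewrite Q.
    assert (Derive u x <> 0) by (intros Z; rewrite Z in Sg; lra).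
    assert (sg <> 0) by (destruct Hsg; lra).
    replace (sg * / s x ^ 2) with (sg ^ 2 * / (sg * s x ^ 2)) by (field; now split).
    replace (sg ^ 2) with 1 by (destruct Hsg as [-> | ->]; ring).
    field. now repeat split. }
  exists (RInt (fun x => / s x ^ 2) t0 t).
  assert (IT : is_RInt (fun x => / s x ^ 2) t0 t (RInt (fun x => / s x ^ 2) t0 t)).
  { apply (RInt_correct (fun x => / s x ^ 2)), (ex_RInt_continuous (fun x => / s x ^ 2)).
    auto. }
  split; [exact IT|].
  assert (IU : is_RInt (fun y => / sqrt (f y)) (u t0) (u t)
                 (RInt (fun y => / sqrt (f y)) (u t0) (u t))).
  { apply (RInt_correct (fun y => / sqrt (f y))), (ex_RInt_continuous (fun y => / sqrt (f y))).
    (* The integrand is known to be continuous only at values taken by [u]; every [y] between the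
       endpoints is such a value. *)
    intros y Hy. destruct (ivt_itv u t0 t y) as [x [Hx <-]]; auto.
    intros x Hx. apply (ex_derive_continuous u). now apply H, B'. }
  replace (sg * RInt (fun x => / s x ^ 2) t0 t)
    with (RInt (fun y => / sqrt (f y)) (u t0) (u t)); [exact IU|].
  (* Substitution [y = u x] in the integral over [y]. *)
  assert (I1 : is_RInt (fun x => sg * / s x ^ 2) t0 t
                 (RInt (fun y => / sqrt (f y)) (u t0) (u t))).
  { apply is_RInt_ext with (fun x => scal (Derive u x) (/ sqrt (f (u x)))).
    - intros x Hx. apply Du, B'. lra.
    - apply (is_RInt_comp (fun y => / sqrt (f y)) u (Derive u)).
      + intros x Hx. now apply Cf, B'.
      + intros x Hx. destruct (H x (B' x Hx)) as [_ [_ [X [C _]]]].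
        split; [now apply Derive_correct | exact C]. }
  rewrite <- (is_RInt_unique _ _ _ _ I1). apply is_RInt_unique.
  exact (is_RInt_scal (fun x => / s x ^ 2) t0 t sg _ IT).
Qed.

Lemma primitive_itv c d (f f1 : R -> R) t0 t :
  (forall x, in_itv c d x -> is_derive f x (f1 x) /\ continuous f1 x) ->
  in_itv c d t0 -> in_itv c d t -> is_RInt f1 t0 t (f t - f t0).
Proof.
  intros H H0 Ht. apply (is_RInt_derive f f1); intros x Hx; apply H;
    now apply (in_itv_between c d t0 t).
Qed.

(** * From the reduced equation to the system *)

Lemma C2_at_entry c d F s u v w t i j :
  new_variables c d F s u v w -> in_itv c d t ->
  C2_at s t -> C2_at u t -> C2_at v t -> C2_at w t ->
  (i < 2)%nat -> (j < 2)%nat -> C2_at (fun x => entry (F x) i j) t.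
Proof.
  intros H Ht Cs Cu Cv Cw Hi Hj.
  assert (E : forall (g : R -> R) i j, C2_at g t ->
    (forall x, in_itv c d x -> entry (F x) i j = g x) -> C2_at (fun x => entry (F x) i j) t).
  { intros g i' j' Cg Hg. apply C2_at_ext_loc with (2 := Cg).
    apply locally_on with (2 := Ht). intros x Hx. symmetry. now apply Hg. }
  assert (C1 : C2_at (fun x => s x * cos (u x)) t) by now apply C2_at_mult, C2_at_cos.
  assert (C2 : C2_at (fun x => s x * sin (u x)) t) by now apply C2_at_mult, C2_at_sin.
  assert (Ccc : C2_at (fun x => cos (v x) * cos (w x)) t)
    by (apply C2_at_mult; now apply C2_at_cos).
  assert (Ccs : C2_at (fun x => cos (v x) * sin (w x)) t)
    by (apply C2_at_mult; [now apply C2_at_cos | now apply C2_at_sin]).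
  assert (Csc : C2_at (fun x => sin (v x) * cos (w x)) t)
    by (apply C2_at_mult; [now apply C2_at_sin | now apply C2_at_cos]).
  assert (Css : C2_at (fun x => sin (v x) * sin (w x)) t)
    by (apply C2_at_mult; now apply C2_at_sin).
  revert j Hj. revert i Hi. refine (lt2_ind _ _ _); refine (lt2_ind _ _ _).
  - eapply E; [|intros x Hx; apply (new_variables_entries c d F s u v w x H Hx)].
    now apply C2_at_minus; apply C2_at_mult.
  - eapply E; [|intros x Hx; apply (new_variables_entries c d F s u v w x H Hx)].
    now apply C2_at_minus; apply C2_at_mult; [apply C2_at_opp|..].
  - eapply E; [|intros x Hx; apply (new_variables_entries c d F s u v w x H Hx)].
    now apply C2_at_plus; apply C2_at_mult.
  - eapply E; [|intros x Hx; apply (new_variables_entries c d F s u v w x H Hx)].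
    now apply C2_at_plus; apply C2_at_mult; [apply C2_at_opp|..].
Qed.

Lemma is_derive_locally_const (f : R -> R) a b k t l :
  (forall x, in_itv a b x -> f x = k) -> in_itv a b t -> is_derive f t l -> l = 0.
Proof.
  intros H Ht D. rewrite <- (is_derive_unique _ _ _ D). apply is_derive_unique.
  apply is_derive_Rext_loc with (fun _ => k); [|apply is_derive_Rconst].
  apply locally_on with (2 := Ht). intros x Hx. symmetry. now apply H.
Qed.

Lemma continuous_zero_dense a b (h g : R -> R) :
  (forall t, in_itv a b t -> continuous h t) ->
  (forall t1 t2, in_itv a b t1 -> in_itv a b t2 -> t1 < t2 ->
     exists t, t1 < t < t2 /\ g t <> 0) ->
  (forall t, in_itv a b t -> g t <> 0 -> h t = 0) ->
  forall t, in_itv a b t -> h t = 0.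
Proof.
  intros Hc Hd Hz t Ht. destruct (Req_dec (h t) 0) as [E|N]; [exact E | exfalso].
  destruct (filter_and _ _ (locally_neq0 h t (Hc t Ht) N) (in_itv_locally a b t Ht)) as [e He].
  assert (L : forall x, t - e < x < t + e -> h x <> 0 /\ in_itv a b x).
  { intros x Hx. apply He. unfold ball; simpl. unfold AbsRing_ball, abs, minus, plus, opp; simpl.
    apply Rabs_def1; lra. }
  pose proof (cond_pos e).
  (* Half the radius keeps both endpoints inside the ball, hence in the interval, as [Hd]
     requires. *)
  destruct (Hd (t - e / 2) (t + e / 2)) as [x [Hx Gx]]; try (apply L; lra); [lra|].
  destruct (L x) as [Nx Ix]; [lra|]. now apply Nx, Hz.
Qed.

(* The residual is orthogonal to [F], [J F], [F J] and [F'] because of the conservation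
   of [Gsq - 2 (E + omega A) t^2 - k1 t], [A], [B] and [E] respectively. *)
Lemma residual_zero U0 omega c d F s u v w E A B k0 k1 t :
  new_variables c d F s u v w ->
  first_integrals U0 2 omega c d F E A B k0 k1 ->
  (forall x, in_itv c d x -> twice_derivable F x /\ det2 (F x) <> 0) ->
  in_itv c d t -> cos (2 * u t) <> 0 -> Derive u t <> 0 ->
  residual U0 omega F 0 0 t = 0 /\ residual U0 omega F 0 1 t = 0 /\
  residual U0 omega F 1 0 t = 0 /\ residual U0 omega F 1 1 t = 0.
Proof.
  intros H HI HT Ht Hc Hu. destruct (HT t Ht) as [T Hd].
  assert (DE := is_derive_locally_const _ c d E t _ (fun x Hx => proj1 (HI x Hx)) Ht
    (is_derive_energy U0 omega F t T Hd)).
  assert (DA := is_derive_locally_const _ c d A t _ (fun x Hx => proj1 (proj2 (HI x Hx))) Ht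
    (is_derive_integralA U0 omega F t T Hd)).
  assert (DB := is_derive_locally_const _ c d B t _ (fun x Hx => proj1 (proj2 (proj2 (HI x Hx)))) Ht
    (is_derive_integralB U0 omega F t T Hd)).
  (* The quadratic law for [G] makes [moment], which is [G'/2], affine with slope [2 (E + omega A)].
     This is the first term of [is_derive_moment], so the product of the residual with [F] must
     vanish. *)
  assert (HM : forall x, in_itv c d x -> moment F x = 2 * (E + omega * A) * x + k1 / 2).
  { intros x Hx. pose proof (is_derive_Gsq F x (proj1 (HT x Hx))) as DG.
    assert (2 * moment F x = 4 * (E + omega * A) * x + k1); [|lra].
    rewrite <- (is_derive_unique _ _ _ DG). apply is_derive_unique.
    apply is_derive_Rext_loc with (fun x => 2 * (E + omega * A) * x ^ 2 + k1 * x + k0).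
    - apply locally_on with (2 := Hx). intros y Hy. symmetry. apply HI, Hy.
    - auto_derive; [easy | ring]. }
  assert (DM : residual U0 omega F 0 0 t * entry (F t) 0 0
    + residual U0 omega F 0 1 t * entry (F t) 0 1
    + residual U0 omega F 1 0 t * entry (F t) 1 0
    + residual U0 omega F 1 1 t * entry (F t) 1 1 = 0).
  { pose proof (is_derive_unique _ _ _ (is_derive_moment U0 omega F t T Hd)) as DM.
    destruct (HI t Ht) as [E1 [E2 _]]. rewrite E1, E2 in DM.
    assert (DM' : Derive (moment F) t = 2 * (E + omega * A)); [|lra].
    apply is_derive_unique.
    apply is_derive_Rext_loc with (fun x => 2 * (E + omega * A) * x + k1 / 2).
    - apply locally_on with (2 := Ht). intros y Hy. symmetry. now apply HM.
    - auto_derive; [easy | ring]. }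
  apply (orthogonal_frame (entry (F t) 0 0) (entry (F t) 0 1) (entry (F t) 1 0)
    (entry (F t) 1 1) (Fdot F 0 0 t) (Fdot F 0 1 t) (Fdot F 1 0 t) (Fdot F 1 1 t));
    try assumption.
  rewrite <- Gsq_entries. fold (moment F t). fold (det2 (F t)).
  destruct (H t Ht) as [Es [Eu _]].
  pose proof (s_neq0 c d F s u v w t H Ht Hd) as Ns.
  assert (EG := Gsq_new_variables c d F s u v w t H Ht).
  assert (ED := det2_new_variables c d F s u v w t H Ht).
  set (dd := Fdot F 0 0 t * _ + _ - _ - _).
  destruct (Derive_invariants c d F s u v w t H Ht T) as [DG DD].
  fold dd in DD.
  (* The value of [k] in [orthogonal_frame]: [G + 2 d] and [G - 2 d] are [s^2 (1 + sin 2u)] and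
     [s^2 (1 - sin 2u)], with product [s^4 cos^2 2u], and [G dd - dG d = G^2 (d / G)' = s^4 u' cos
     2u] because [d / G = sin 2u / 2]. *)
  assert (Nk : (s t ^ 2) ^ 4 * cos (2 * u t) ^ 3 * Derive u t <> 0).
  { apply Rmult_integral_contrapositive_currified; [|exact Hu].
    apply Rmult_integral_contrapositive_currified;
      repeat apply pow_nonzero; assumption. }
  intros Z. apply Nk. rewrite <- Z, ED, EG.
  pose proof (cos_2a_sqr (u t)) as C2.
  replace (det2 (F t)) with (s t ^ 2 * sin (2 * u t) / 2) by lra.
  rewrite DG.
  replace dd with (s t * Derive s t * sin (2 * u t) + s t ^ 2 * (Derive u t * cos (2 * u t)))
    by lra.
  replace (cos (2 * u t) ^ 3) with (cos (2 * u t) ^ 2 * cos (2 * u t)) by ring.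
  rewrite C2. field.
Qed.

Lemma continuous_residual U0 omega a b F i j t :
  (forall x, in_itv a b x -> det2 (F x) <> 0 /\
     forall i j, (i < 2)%nat -> (j < 2)%nat -> C2_at (fun x => entry (F x) i j) x) ->
  in_itv a b t -> (i < 2)%nat -> (j < 2)%nat -> continuous (residual U0 omega F i j) t.
Proof.
  intros H Ht Hi Hj. destruct (H t Ht) as [Hd HC].
  assert (Ce : forall i j, (i < 2)%nat -> (j < 2)%nat -> C1_at (fun x => entry (F x) i j) t).
  { intros i' j' Hi' Hj'. exact (C2_at_C1_at _ _ (HC i' j' Hi' Hj')). }
  assert (C1 : forall i j, (i < 2)%nat -> (j < 2)%nat -> C1_at (Fdot F i j) t).
  { intros i' j' Hi' Hj'. exact (proj2 (HC i' j' Hi' Hj')). }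
  assert (CD : C1_at (fun x => det2 (F x)) t).
  { unfold det2. apply C1_at_minus; apply C1_at_mult; auto. }
  assert (CU : forall i j, (i < 2)%nat -> (j < 2)%nat ->
    continuous (fun x => U0 * entry (F x) i j / det2 (F x) ^ 2) t).
  { intros i' j' Hi' Hj'.
    apply (C1_at_continuous (fun x => U0 * entry (F x) i' j' / det2 (F x) ^ 2)).
    apply (C1_at_div (fun x => U0 * entry (F x) i' j') (fun x => det2 (F x) ^ 2)).
    - apply C1_at_mult; [apply C1_at_const | auto].
    - now apply C1_at_sqr.
    - now apply pow_nonzero. }
  assert (Cd : forall i j, (i < 2)%nat -> (j < 2)%nat ->
    continuous (fun x => 2 * omega * Fdot F i j x) t).
  { intros i' j' Hi' Hj'. apply continuous_Rmult; [apply continuous_const|].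
    exact (C1_at_continuous _ _ (C1 i' j' Hi' Hj')). }
  assert (Cq : forall i j, (i < 2)%nat -> (j < 2)%nat ->
    continuous (fun x => omega ^ 2 * entry (F x) i j) t).
  { intros i' j' Hi' Hj'. apply continuous_Rmult; [apply continuous_const|].
    exact (C1_at_continuous _ _ (Ce i' j' Hi' Hj')). }
  assert (Cdd : forall i j, (i < 2)%nat -> (j < 2)%nat -> continuous (Fddot F i j) t).
  { intros i' j' Hi' Hj'. exact (proj2 (C1 i' j' Hi' Hj')). }
  (* The closed form of the residual holds only where the determinant is nonzero; this is the case
     near [t], which suffices for continuity. *)
  assert (X : forall (g : R -> R) i j, continuous g t ->
    (forall x, det2 (F x) <> 0 -> residual U0 omega F i j x = g x) ->
    continuous (residual U0 omega F i j) t).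
  { intros g i' j' Cg Hg. apply continuous_ext_loc with (2 := Cg).
    apply locally_on with (2 := Ht). intros x Hx. symmetry. exact (Hg x (proj1 (H x Hx))). }
  revert j Hj. revert i Hi. refine (lt2_ind _ _ _); refine (lt2_ind _ _ _).
  - eapply X; [|intros x Hx; apply (residual_entries U0 omega F x Hx)].
    apply continuous_Rminus; [apply continuous_Rminus; [apply continuous_Rminus|]|]; auto.
  - eapply X; [|intros x Hx; apply (residual_entries U0 omega F x Hx)].
    apply continuous_Rminus; [apply continuous_Rminus; [apply continuous_Rplus|]|]; auto.
  - eapply X; [|intros x Hx; apply (residual_entries U0 omega F x Hx)].
    apply continuous_Rminus; [apply continuous_Rplus; [apply continuous_Rplus|]|]; auto.
  - eapply X; [|intros x Hx; apply (residual_entries U0 omega F x Hx)].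
    apply continuous_Rminus; [apply continuous_Rplus; [apply continuous_Rminus|]|]; auto.
Qed.

(** * Assembly of the two directions *)

Lemma motion_reduction U0 omega a b F E A B k0 k1 c d s u v w :
  is_motion U0 2 omega (2 * omega) 1 1 a b F ->
  first_integrals U0 2 omega a b F E A B k0 k1 ->
  (forall t, in_itv c d t -> in_itv a b t) ->
  new_variables c d F s u v w ->
  forall t, in_itv c d t -> cos (2 * u t) <> 0 ->
    reduced_ode U0 A B (radicandD omega E A k0 k1) s u t /\
    is_derive v t (v_rate omega A B s u t) /\ is_derive w t (w_rate A B s u t).
Proof.
  rewrite is_motion_residual. intros HM HI Hsub H t Ht Hc.
  destruct (HM t (Hsub t Ht)) as [Hd _].
  destruct (HI t (Hsub t Ht)) as [EE [EA [EB _]]].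
  destruct (H t Ht) as [_ [Hu [Hv [Hw _]]]].
  assert (HG : forall x, in_itv c d x -> s x ^ 2 = 2 * (E + omega * A) * x ^ 2 + k1 * x + k0).
  { intros x Hx. rewrite <- (Gsq_new_variables c d F s u v w x H Hx). apply HI, Hsub, Hx. }
  rewrite <- EA in HG.
  pose proof (radicand_new_variables U0 omega c d F s u v w E k0 k1 t H Ht Hd Hc HG) as RE.
  rewrite EE, EA, EB in RE.
  pose proof (s_neq0 c d F s u v w t H Ht Hd) as Ns.
  split.
  - apply reduced_ode_iff; [exact Ns | exact Hu |]. rewrite RE. ring.
  - rewrite <- EA, <- EB.
    rewrite <- (v_rate_new_variables c d F s u v w t H Ht Hd Hc omega).
    rewrite <- (w_rate_new_variables c d F s u v w t H Ht Hd Hc omega).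
    split; now apply Derive_correct.
Qed.

Lemma motion_u_quadrature U0 omega a b F E A B k0 k1 c d s u v w :
  is_motion U0 2 omega (2 * omega) 1 1 a b F ->
  first_integrals U0 2 omega a b F E A B k0 k1 ->
  (forall t, in_itv c d t -> in_itv a b t) ->
  new_variables c d F s u v w ->
  (forall t, in_itv c d t ->
     cos (2 * u t) <> 0 /\ 0 < radicand U0 A B (radicandD omega E A k0 k1) (u t)) ->
  u_quadrature U0 A B (radicandD omega E A k0 k1) s u c d.
Proof.
  intros HM HI Hsub H HP.
  assert (HR := motion_reduction U0 omega a b F E A B k0 k1 c d s u v w HM HI Hsub H).
  rewrite is_motion_residual in HM.
  assert (HN : forall x, in_itv c d x -> twice_derivable F x /\ s x <> 0 /\ cos (2 * u x) <> 0).
  { intros x Hx. destruct (HM x (Hsub x Hx)) as [Hd [T _]]. split; [exact T|].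
    split; [now apply (s_neq0 c d F s u v w) | now apply HP]. }
  apply u_quadrature_of_reduced. intros t Ht.
  destruct (HM t (Hsub t Ht)) as [Hd _]. destruct (H t Ht) as [Hs [Hu _]].
  destruct (HN t Ht) as [_ [Ns Nc]]. destruct (HP t Ht) as [_ P].
  repeat split; try assumption.
  - now apply (continuous_Derive_u c d F s u v w).
  - now apply (sin_2u_neq0 c d F s u v w).
  - apply reduced_ode_iff; [exact Ns | exact Hu | now apply HR].
Qed.

Lemma motion_vw_quadratures U0 omega a b F E A B k0 k1 c d s u v w :
  is_motion U0 2 omega (2 * omega) 1 1 a b F ->
  first_integrals U0 2 omega a b F E A B k0 k1 ->
  (forall t, in_itv c d t -> in_itv a b t) ->
  new_variables c d F s u v w ->
  (forall t, in_itv c d t -> cos (2 * u t) <> 0) ->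
  vw_quadratures omega A B s u v w c d.
Proof.
  intros HM HI Hsub H HP.
  assert (HR := motion_reduction U0 omega a b F E A B k0 k1 c d s u v w HM HI Hsub H).
  rewrite is_motion_residual in HM.
  assert (HC : forall t, in_itv c d t ->
    continuous (v_rate omega A B s u) t /\ continuous (w_rate A B s u) t).
  { intros t Ht. destruct (HM t (Hsub t Ht)) as [Hd _]. destruct (H t Ht) as [Hs [Hu _]].
    pose proof (s_neq0 c d F s u v w t H Ht Hd) as Ns.
    assert (Nd : s t ^ 2 * cos (2 * u t) ^ 2 <> 0).
    { apply Rmult_integral_contrapositive_currified; apply pow_nonzero; auto. }
    split.
    - apply (ex_derive_continuous (v_rate omega A B s u)). unfold v_rate. now auto_derive.
    - apply (ex_derive_continuous (w_rate A B s u)). unfold w_rate. now auto_derive. }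
  intros t0 t H0 Ht. split; apply (primitive_itv c d); auto; intros x Hx;
    (split; [now apply HR; [|apply HP] | now apply HC]).
Qed.

(** [A] and [B] follow by inserting the rates into their linear expressions. For the energy, the
    squared reduced equation and [radicand_new_variables] differ by [2 s^2 (E - energy)], and [s]
    does not vanish. *)
Lemma reduction_first_integrals U0 omega c d F E A B k0 k1 s u v w :
  new_variables c d F s u v w ->
  (forall t, in_itv c d t ->
     s t <> 0 /\ sin (2 * u t) <> 0 /\ cos (2 * u t) <> 0 /\
     s t ^ 2 = 2 * (E + omega * A) * t ^ 2 + k1 * t + k0) ->
  (forall t, in_itv c d t ->
     reduced_ode U0 A B (radicandD omega E A k0 k1) s u t /\
     is_derive v t (v_rate omega A B s u t) /\ is_derive w t (w_rate A B s u t)) ->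
  (forall t, in_itv c d t -> det2 (F t) <> 0) /\
  first_integrals U0 2 omega c d F E A B k0 k1.
Proof.
  intros H HN HR.
  assert (Hdet : forall t, in_itv c d t -> det2 (F t) <> 0).
  { intros t Ht Z. destruct (HN t Ht) as [Ns [NS _]].
    pose proof (det2_new_variables c d F s u v w t H Ht) as D. rewrite Z, Rmult_0_r in D.
    symmetry in D. destruct (Rmult_integral _ _ D) as [D'|D']; [|contradiction].
    now apply (pow_nonzero (s t) 2). }
  split; [exact Hdet|]. intros t Ht. specialize (Hdet t Ht).
  destruct (HN t Ht) as [Ns [NS [Nc HG]]]. destruct (HR t Ht) as [HO [Dv Dw]].
  destruct (H t Ht) as [_ [Hu _]].
  pose proof (cos_2a_sqr (u t)) as T.
  assert (N1 : 1 - sin (2 * u t) ^ 2 <> 0) by (rewrite <- T; now apply pow_nonzero).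
  assert (EA : integralA omega F t = A).
  { rewrite (integralA_new_variables c d F s u v w t H Ht).
    rewrite (is_derive_unique _ _ _ Dv), (is_derive_unique _ _ _ Dw).
    unfold v_rate, w_rate. rewrite T. field. now split. }
  assert (EB : integralB omega F t = B).
  { rewrite (integralB_new_variables c d F s u v w t H Ht).
    rewrite (is_derive_unique _ _ _ Dv), (is_derive_unique _ _ _ Dw).
    unfold v_rate, w_rate. rewrite T. field. now split. }
  assert (HG' : forall x, in_itv c d x ->
    s x ^ 2 = 2 * (E + omega * integralA omega F t) * x ^ 2 + k1 * x + k0).
  { intros x Hx. rewrite EA. now apply HN. }
  pose proof (radicand_new_variables U0 omega c d F s u v w E k0 k1 t H Ht Hdet Nc HG') as RE.
  rewrite EA, EB in RE.
  apply reduced_ode_iff in HO; [|exact Ns|exact Hu].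
  repeat split; [|exact EA|exact EB|].
  - assert (Z : 2 * s t ^ 2 * (E - energy U0 2 omega F t) = 0) by lra.
    assert (Ns2 : s t ^ 2 <> 0) by now apply pow_nonzero.
    destruct (Rmult_integral _ _ Z); lra.
  - now rewrite (Gsq_new_variables c d F s u v w t H Ht).
Qed.

(** Regularity is inherited from [u]: the law for [s^2] gives [s' = (2 K t + k1 / 2) / s], first
    continuous and then continuously differentiable, after which the rates of [v] and [w] are of
    class C1 as expressions in [s] and [u]. *)
Lemma C2_at_new_variables omega c d K k0 k1 A B (s u v w : R -> R) t :
  (forall x, in_itv c d x ->
     s x <> 0 /\ ex_derive s x /\ s x ^ 2 = 2 * K * x ^ 2 + k1 * x + k0) ->
  (forall x, in_itv c d x ->
     cos (2 * u x) <> 0 /\ ex_derive u x /\ ex_derive (Derive u) x /\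
     continuous (Derive (Derive u)) x) ->
  (forall x, in_itv c d x ->
     is_derive v x (v_rate omega A B s u x) /\ is_derive w x (w_rate A B s u x)) ->
  in_itv c d t -> C2_at s t /\ C2_at u t /\ C2_at v t /\ C2_at w t.
Proof.
  intros Hs Hu Hvw Ht.
  destruct (Hs t Ht) as [Ns [Es _]]. destruct (Hu t Ht) as [Nc [Eu [Eu' Cu]]].
  assert (Ds : forall x, in_itv c d x -> is_derive s x ((2 * K * x + k1 / 2) / s x)).
  { intros x Hx. destruct (Hs x Hx) as [N [X _]].
    rewrite <- (Derive_sqr_quadratic c d s K k0 k1 x); auto; [|intros y Hy; now apply Hs].
    apply is_derive_eq with (Derive s x); [now apply Derive_correct | now field]. }
  assert (C1s : C1_at s t).
  { apply C1_at_intro with (fun x => (2 * K * x + k1 / 2) / s x).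
    - apply locally_on with (2 := Ht). exact Ds.
    - apply (ex_derive_continuous (fun x => (2 * K * x + k1 / 2) / s x)). now auto_derive. }
  assert (C2u : C2_at u t).
  { split.
    - apply locally_on with (2 := Ht). intros x Hx. now apply Hu.
    - split; [|exact Cu]. apply locally_on with (2 := Ht). intros x Hx. now apply Hu. }
  destruct (C1_at_rates omega A B s u t C1s (C2_at_C1_at _ _ C2u) Ns Nc) as [Cv Cw].
  split; [|split; [exact C2u|split]].
  - apply C2_at_intro with (fun x => (2 * K * x + k1 / 2) / s x).
    + apply locally_on with (2 := Ht). exact Ds.
    + apply (C1_at_div (fun x => 2 * K * x + k1 / 2) s); [|exact C1s|exact Ns].
      apply C1_at_intro with (fun _ => 2 * K).
      * apply filter_forall. intros x. auto_derive; [easy | ring].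
      * apply continuous_const.
  - apply C2_at_intro with (2 := Cv). apply locally_on with (2 := Ht). intros x Hx. now apply Hvw.
  - apply C2_at_intro with (2 := Cw). apply locally_on with (2 := Ht). intros x Hx. now apply Hvw.
Qed.

Theorem theorem3p2 (omega U0 : R) (homega : 0 < omega) (hU0 : 0 < U0) :
  (* From the system to the equation for u, and its integration. *)
  (forall (a b : Rbar) (F : R -> mat2),
     is_motion U0 2 omega (2 * omega) 1 1 a b F ->
     exists E A B k0 k1 : R,
       first_integrals U0 2 omega a b F E A B k0 k1 /\
       forall c d : Rbar,
         (forall t, in_itv c d t -> in_itv a b t) ->
         (* away from the matrices with equal singular values, where
            cos 2u = 0, the new variables exist *)
         ((forall t, in_itv c d t -> 2 * Rabs (det2 (F t)) < Gsq (F t)) ->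
          exists s u v w : R -> R,
            new_variables c d F s u v w /\
            forall t, in_itv c d t -> cos (2 * u t) <> 0) /\
         (forall s u v w : R -> R,
            new_variables c d F s u v w ->
            (forall t, in_itv c d t -> s t ^ 2 = Gsq (F t)) /\
            (forall t, in_itv c d t -> cos (2 * u t) <> 0 ->
               reduced_ode U0 A B (radicandD omega E A k0 k1) s u t /\
               is_derive v t (v_rate omega A B s u t) /\
               is_derive w t (w_rate A B s u t)) /\
            ((forall t, in_itv c d t ->
                cos (2 * u t) <> 0 /\
                0 < radicand U0 A B (radicandD omega E A k0 k1) (u t)) ->
             u_quadrature U0 A B (radicandD omega E A k0 k1) s u c d) /\
            ((forall t, in_itv c d t -> cos (2 * u t) <> 0) ->
             vw_quadratures omega A B s u v w c d)))
  /\
  (* From the equation for u back to the system.  A constant u at a zero of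
     the radicand always satisfies the reduced equation, so u is required not to be
     constant on any subinterval. *)
  (forall (c d : Rbar) (E A B k0 k1 : R) (F : R -> mat2) (s u v w : R -> R),
     new_variables c d F s u v w ->
     (forall t, in_itv c d t ->
        s t <> 0 /\ sin (2 * u t) <> 0 /\ cos (2 * u t) <> 0 /\
        s t ^ 2 = 2 * (E + omega * A) * t ^ 2 + k1 * t + k0) ->
     (forall t, in_itv c d t ->
        ex_derive (Derive u) t /\ continuous (Derive (Derive u)) t) ->
     (forall t1 t2, in_itv c d t1 -> in_itv c d t2 -> t1 < t2 ->
        exists t, t1 < t < t2 /\ Derive u t <> 0) ->
     (forall t, in_itv c d t ->
        reduced_ode U0 A B (radicandD omega E A k0 k1) s u t /\
        is_derive v t (v_rate omega A B s u t) /\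
        is_derive w t (w_rate A B s u t)) ->
     is_motion U0 2 omega (2 * omega) 1 1 c d F /\
     first_integrals U0 2 omega c d F E A B k0 k1).
Proof.
  split.
  - intros a b F HM. destruct (motion_first_integrals U0 omega a b F HM)
      as [E [A [B [k0 [k1 HI]]]]].
    exists E, A, B, k0, k1. split; [exact HI|]. intros c d Hsub. split.
    + apply new_variables_exist. intros t Ht.
      now apply (proj1 (is_motion_residual U0 omega a b F) HM t (Hsub t Ht)).
    + intros s u v w H. split; [|split; [|split]].
      * intros t Ht. symmetry. now apply (Gsq_new_variables c d F s u v w).
      * now apply (motion_reduction U0 omega a b F E A B k0 k1 c d s u v w).
      * now apply (motion_u_quadrature U0 omega a b F E A B k0 k1 c d s u v w).
      * now apply (motion_vw_quadratures U0 omega a b F E A B k0 k1 c d s u v w).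
  - intros c d E A B k0 k1 F s u v w H HN HU HD HR.
    destruct (reduction_first_integrals U0 omega c d F E A B k0 k1 s u v w H HN HR)
      as [Hdet HI].
    split; [|exact HI].
    assert (HC : forall t i j, in_itv c d t -> (i < 2)%nat -> (j < 2)%nat ->
      C2_at (fun x => entry (F x) i j) t).
    { intros t i j Ht Hi Hj.
      destruct (C2_at_new_variables omega c d (E + omega * A) k0 k1 A B s u v w t)
        as [C1 [C2 [C3 C4]]]; [ | | | exact Ht |].
      - intros x Hx. destruct (HN x Hx) as [N1 [_ [_ N4]]]. destruct (H x Hx) as [X _]. auto.
      - intros x Hx. destruct (HN x Hx) as [_ [_ [N3 _]]]. destruct (H x Hx) as [_ [X _]].
        destruct (HU x Hx). auto.
      - intros x Hx. now apply HR.
      - now apply (C2_at_entry c d F s u v w). }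
    assert (HT : forall t, in_itv c d t -> twice_derivable F t).
    { intros t Ht i j Hi Hj. specialize (HC t i j Ht Hi Hj). split.
      - exact (C1_at_ex_derive _ _ (C2_at_C1_at _ _ HC)).
      - exact (C1_at_ex_derive _ _ (proj2 HC)). }
    assert (HQ : forall t, in_itv c d t -> Derive u t <> 0 ->
      residual U0 omega F 0 0 t = 0 /\ residual U0 omega F 0 1 t = 0 /\
      residual U0 omega F 1 0 t = 0 /\ residual U0 omega F 1 1 t = 0).
    { intros t Ht Hu. apply (residual_zero U0 omega c d F s u v w E A B k0 k1 t H HI);
        auto. now apply HN. }
    assert (CQ : forall i j, (i < 2)%nat -> (j < 2)%nat ->
      forall t, in_itv c d t -> continuous (residual U0 omega F i j) t).
    { intros i j Hi Hj t Ht. apply (continuous_residual U0 omega c d); auto. }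
    apply is_motion_residual. intros t Ht.
    split; [now apply Hdet|]. split; [now apply HT|].
    (* By [HD] the times with nonzero [u'] are dense, so continuity carries the vanishing of each
       residual entry over to [t]. *)
    assert (Z : forall i j, (i < 2)%nat -> (j < 2)%nat ->
      (forall x, in_itv c d x -> Derive u x <> 0 -> residual U0 omega F i j x = 0) ->
      residual U0 omega F i j t = 0).
    { intros i j Hi Hj Hz.
      exact (continuous_zero_dense c d _ (Derive u) (CQ i j Hi Hj) HD Hz t Ht). }
    refine (conj _ (conj _ (conj _ _))); apply Z; auto; intros x Hx Nx; apply (HQ x Hx Nx).
Qed.
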